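(* Let $a\in(0,1)$, $p\in(0,1)$, and let $X=(X_t)_{t=0,\dots,n}$ be a stationary Markov chain generated by the copula $C(u,v)=a\min(u,v)+(1-a)\max(u+v-1,0)$ and Bernoulli($p$) marginal distribution, and let $\bar p=\frac1{n+1}\sum_{t=0}^nX_t$ be the sample mean. Then $\sqrt{n+1}(\bar p-p)\to N(0,\sigma^2)$ in distribution as $n\to\infty$, where $\sigma^2=\frac{p(1-p)(1+a-2p)}{1-a}$ if $p<1/2$ and $\sigma^2=\frac{p(1-p)(a+2p-1)}{1-a}$ if $p\ge1/2$.
   Context: A stationary Markov chain $(X_t)$ is generated by a copula $C$ and a marginal cdf $F$ if each $X_t$ has cdf $F$ and $P(X_t\le x,X_{t+1}\le y)=C(F(x),F(y))$ for all $x,y$; Bernoulli($p$) means $P(X_t=1)=p=1-P(X_t=0)$. *)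

(* Defs.v *)
From HB Require Import structures.
From mathcomp Require Import all_boot all_order all_algebra.
From mathcomp Require Import all_classical all_reals all_analysis.
Set Implicit Arguments. Unset Strict Implicit. Unset Printing Implicit Defensive.
Import Order.TTheory GRing.Theory Num.Theory.
Import numFieldNormedType.Exports.
Local Open Scope classical_set_scope.
Local Open Scope ring_scope.

Section defs.
Context {R : realType}.

Definition bernoulli_cdf (p x : R) : R :=
  if x < 0 then 0 else if x < 1 then 1 - p else 1.

Definition mix_copula (a u v : R) : R :=
  a * Num.min u v + (1 - a) * Num.max (u + v - 1) 0.

Context {d : measure_display} {T : measurableType d}.

(* Markov property of a discrete-valued process X_0, X_1, ... :
   P(X_0=x_0,...,X_{t+1}=x_{t+1}) P(X_t=x_t)
     = P(X_0=x_0,...,X_t=x_t) P(X_t=x_t, X_{t+1}=x_{t+1}),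
   i.e. P(X_{t+1}=x_{t+1} | X_0..X_t) = P(X_{t+1}=x_{t+1} | X_t) *)
Definition discrete_markov (P : probability T R) (X : nat -> T -> R) : Prop :=
  forall (t : nat) (x : nat -> R),
    (P (\bigcap_(s in `I_(t.+2)) [set w | X s w = x s]) * P [set w | X t w = x t]
     = P (\bigcap_(s in `I_(t.+1)) [set w | X s w = x s])
       * P ([set w | X t w = x t] `&` [set w | X t.+1 w = x t.+1]))%E.

Definition copula_markov_chain (P : probability T R) (X : nat -> T -> R)
    (C : R -> R -> R) (F : R -> R) : Prop :=
  [/\ forall t, measurable_fun setT (X t),
      discrete_markov P X,
      forall t x, P [set w | X t w <= x] = (F x)%:E &
      forall t x y, P ([set w | X t w <= x] `&` [set w | X t.+1 w <= y])
                    = (C (F x) (F y))%:E].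

Definition cvg_in_distribution (P : probability T R) (Z : nat -> T -> R)
    (mu : set R -> \bar R) : Prop :=
  forall x : R, {for x, continuous (fun y : R => fine (mu [set` `]-oo, y]]))} ->
    (P [set w | Z n w <= x]) @[n --> \oo] --> mu [set` `]-oo, x]].

End defs.

(* Main.v *)
(* Write y = X - p for the centred states, lam for the nontrivial eigenvalue of
   the transition matrix and S for the partial sums of y. Then
   M = S + lam/(1-lam) y is a martingale whose jumps have conditional variance
   sig2 + const * y; adding to cos(tau M + th) a corrector of order tau^2 y makes
   one step of the chain multiply its mean by exp(- tau^2 sig2 / 2) up to
   O(tau^3), so that with tau = t / sqrt(n+1) the means of cos(t W_n + th)
   converge to exp(- t^2 sig2 / 2) cos th, W_n being the normalised sum. The
   Gaussian means of the same functions are computed by the usual differential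
   equation in t. Finally, indicators of half-lines are bracketed by trigonometric
   polynomials up to a small multiple of x^2, and E[W_n^2] is bounded. *)

Require Import Defs.
From HB Require Import structures.
From mathcomp Require Import all_boot all_order all_algebra.
From mathcomp Require Import all_classical all_reals all_analysis.
From mathcomp Require Import measurable_realfun ring lra.
Import Order.TTheory GRing.Theory Num.Theory.
Import numFieldNormedType.Exports.
Local Open Scope classical_set_scope.
Local Open Scope ring_scope.

(** Given the current state, an increment of S is not centred, and the variance of a jump of M is
    not constant. Each defect is a multiple of y, an eigenvector of the transition matrix, so each
    is removed by a multiple of y divided by [1 - lam]. An error O(tau^3) per step is affordable: n
    steps with tau of order n^(-1/2) leave O(n^(-1/2)). Cosines with an arbitrary phase [th] replace
    complex exponentials: they contain the sines and their span is closed under products, so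
    everything stays real. Up to null sets the process is an infinite Boolean sequence, and the law
    of its first [n.+1] terms is a finite weighted sum over lists. The marginal and the copula enter
    this law only through p and the probability that two consecutive states vanish, which fixes
    [lam]. The variance is always p(1-p)(1+lam)/(1-lam); the two cases of the theorem come from the
    sign of 1-2p in the max of the copula. *)

Lemma norm_le_of_deriv (R : realType) (f df : R -> R) (k : nat) :
  (forall x, is_derive x (1 : R) f (df x)) -> f 0 = 0 ->
  (forall x, `|df x| <= `|x| ^+ k) -> forall x, `|f x| <= `|x| ^+ k.+1.
Proof.
move=> fd f0 dfle x.
have fc : continuous f by move=> z; apply/differentiable_continuous/derivable1_diffP.
have key : forall a b, a <= b -> `|a| <= `|x| -> `|b| <= `|x| ->
    `|f b - f a| <= `|x| ^+ k * `|b - a|.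
  move=> a b ab ax bx.
  have [|c cab ->] := @MVT_segment R f df a b ab (fun z _ => fd z).
    exact: continuous_subspaceT.
  rewrite normrM ler_wpM2r// (le_trans (dfle _))// lerXn2r ?nnegrE//.
  move: cab; rewrite in_itv/= => /andP[ac cb].
  move: ax bx; rewrite !ler_norml => /andP[a1 a2] /andP[b1 b2].
  by rewrite (le_trans a1 ac) (le_trans cb b2).
rewrite exprSr; have [x0|x0] := leP 0 x.
  by have := key 0 x x0; rewrite f0 !subr0 normr0; exact.
have := key x 0 (ltW x0); rewrite f0 sub0r normrN sub0r normrN normr0; exact.
Qed.

Section cos_taylor.
Context {R : realType}.
Implicit Types u d : R.

Lemma norm_cosB_le u d : `|cos (u + d) - cos u| <= `|d|.
Proof.
rewrite -[leRHS]expr1.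
apply: (@norm_le_of_deriv R (fun d => cos (u + d) - cos u) (fun d => - sin (u + d)) 0).
- by move=> x; apply: is_derive_eq; rewrite /=; ring.
- by rewrite /= ?addr0 subrr.
- by move=> x; rewrite expr0 normrN sin_max.
Qed.

(** The derivative in [d] of this remainder is again a remainder, whose own derivative is controlled
    by [norm_cosB_le]; two uses of the mean value bound suffice. The sharper factor 1/6 is given up,
    since only the order matters. *)
Lemma norm_cos_taylor2_le u d :
  `|cos (u + d) - cos u + d * sin u + d ^+ 2 / 2 * cos u| <= `|d| ^+ 3.
Proof.
apply: (@norm_le_of_deriv R
  (fun d => cos (u + d) - cos u + d * sin u + d ^+ 2 / 2 * cos u)
  (fun d => - sin (u + d) + sin u + d * cos u) 2).
- move=> x; apply: is_derive_eq; rewrite /GRing.scale /=; lra.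
- by rewrite /= ?addr0; ring.
move=> {}d; apply: (@norm_le_of_deriv R
  (fun d => - sin (u + d) + sin u + d * cos u)
  (fun d => - cos (u + d) + cos u) 1).
- by move=> x; apply: is_derive_eq; rewrite /GRing.scale /=; ring.
- by rewrite /= ?addr0; ring.
move=> {}d; rewrite expr1 -normrN opprD opprK; exact: norm_cosB_le.
Qed.

End cos_taylor.

(** * Two-state chains *)

Section two_state_chain.
Context {R : realType} (p lam : R).

(* Transition probability from [b] to [b'] of the stationary {0,1}-chain of
   mean [p] whose nontrivial eigenvalue is [lam]. *)
Definition trans (b b' : bool) : R :=
  let r := p + lam * (b%:R - p) in if b' then r else 1 - r.

(* Paths are listed backwards in time: the head is the current state. *)
Fixpoint path_weight (s : seq bool) : R :=
  match s with
  | [::] => 0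
  | b :: s' => if s' is b' :: _ then trans b' b * path_weight s'
               else if b then p else 1 - p
  end.

Definition path_mean n (G : seq bool -> R) : R :=
  \sum_(s : n.+1.-tuple bool) path_weight s * G s.

Definition csum (s : seq bool) : R := \sum_(b <- s) (b%:R - p).

Definition cur (s : seq bool) : R := (head false s)%:R - p.

(* A martingale: [lam / (1 - lam) * cur] solves the Poisson equation. *)
Definition mart (s : seq bool) : R := csum s + lam / (1 - lam) * cur s.

(** Nonemptiness matters: the empty list has the dummy weight [0], whereas a single state carries
    the initial law. *)
Lemma path_weight_cons (b : bool) (s : seq bool) : (0 < size s)%N ->
  path_weight (b :: s) = trans (head false s) b * path_weight s.
Proof. by case: s. Qed.

Lemma big_tuple_cons n (F : seq bool -> R) :
  \sum_(s : n.+1.-tuple bool) F s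
  = \sum_(s : n.-tuple bool) (F (true :: s) + F (false :: s)).
Proof.
pose h (u : n.-tuple bool * bool) : n.+1.-tuple bool := [tuple of u.2 :: u.1].
rewrite (reindex h) /=; last first.
  exists (fun s : n.+1.-tuple bool => ([tuple of behead s], thead s)).
  - by move=> [s b] _; congr pair; apply/val_inj.
  - by move=> s _; rewrite [s]tuple_eta; apply/val_inj.
rewrite -(pair_bigA _ (fun (s : n.-tuple bool) b => F (b :: s))) /=.
by apply: eq_bigr => s _; rewrite big_bool.
Qed.

Lemma path_meanS n G : path_mean n.+1 G =
  path_mean n (fun s => trans (head false s) true * G (true :: s)
                      + trans (head false s) false * G (false :: s)).
Proof.
rewrite /path_mean.
rewrite (big_tuple_cons n.+1 (fun s => path_weight s * G s)).
apply: eq_bigr => s _.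
by rewrite !path_weight_cons ?size_tuple//; ring.
Qed.

Lemma path_mean0 G : path_mean 0 G = p * G [:: true] + (1 - p) * G [:: false].
Proof.
rewrite /path_mean (big_tuple_cons 0 (fun s => path_weight s * G s)).
by rewrite (big_pred1 [tuple]) //= => s; apply/esym/eqP; exact: tuple0.
Qed.

Lemma path_meanD n G H :
  path_mean n (fun s => G s + H s) = path_mean n G + path_mean n H.
Proof. by rewrite -big_split; apply: eq_bigr => s _; rewrite mulrDr. Qed.

Lemma path_meanZ n k G : path_mean n (fun s => k * G s) = k * path_mean n G.
Proof. by rewrite mulr_sumr; apply: eq_bigr => s _; rewrite mulrCA. Qed.

Lemma path_meanB n G H :
  path_mean n (fun s => G s - H s) = path_mean n G - path_mean n H.
Proof. by rewrite -sumrB; apply: eq_bigr => s _; rewrite mulrBr. Qed.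

Hypothesis p01 : 0 < p < 1.
Hypothesis lam1 : `|lam| < 1.
Hypothesis trans01 : forall b b', 0 <= trans b b'.

Lemma path_weight_ge0 s : 0 <= path_weight s.
Proof.
elim: s => //= b [|b' s] ih; last by rewrite mulr_ge0.
by case/andP: p01 => *; case: b; lra.
Qed.

Lemma le_path_mean n G H : (forall s, G s <= H s) ->
  path_mean n G <= path_mean n H.
Proof.
by move=> GH; apply: ler_sum => s _; rewrite ler_wpM2l// path_weight_ge0.
Qed.

Lemma path_mean_cst n k : path_mean n (fun=> k) = k.
Proof.
elim: n => [|n ih]; first by rewrite path_mean0; ring.
rewrite path_meanS -[RHS]ih; congr path_mean; apply/funext => s.
by rewrite /trans; ring.
Qed.

Lemma norm_path_mean_le n G k : (forall s, `|G s| <= k) -> `|path_mean n G| <= k.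
Proof.
move=> Gk; rewrite ler_norml; apply/andP; split.
  rewrite -[X in X <= _](path_mean_cst n (- k)).
  by apply: le_path_mean => s; have := Gk s; rewrite ler_norml => /andP[].
rewrite -[X in _ <= X](path_mean_cst n k).
by apply: le_path_mean => s; have := Gk s; rewrite ler_norml => /andP[].
Qed.

(** From state [b] the next state has mean [p + lam * (b%:R - p)], so the numerator is centred. The
    denominator collects the increment of [csum] and that of the Poisson term. *)
Definition jump (b b' : bool) : R := (b'%:R - p - lam * (b%:R - p)) / (1 - lam).

Let lam_neq1 : 1 - lam != 0.
Proof. by move: lam1; rewrite ltr_norml => /andP[? ?]; apply/eqP; lra. Qed.

(** Valid for the empty list as well, because [cur] and [head] use the same default state; the base
    case of the second moment bound relies on it. *)
Lemma mart_cons b s : mart (b :: s) = mart s + jump (head false s) b.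
Proof.
rewrite /mart /csum /cur /jump big_cons /=.
by field.
Qed.

(** With y = b - p one has y^2 = p(1-p) + (1-2p)y, so the variance of [jump b b'] given [b] is
    [sig2] + (1-2p) lam/(1-lam) y. It is also the series of the stationary covariances p(1-p)
    lam^|k| over all integers k. *)
Definition sig2 : R := p * (1 - p) * (1 + lam) / (1 - lam).

Definition jbound : R := 2 / (1 - lam).

Lemma jbound_ge0 : 0 <= jbound.
Proof. by move: lam1; rewrite ltr_norml => /andP[? ?]; apply: divr_ge0; lra. Qed.

Lemma norm_centred_le (b : bool) : `|b%:R - p| <= 1.
Proof. by case/andP: p01 => *; case: b; rewrite ler_norml /=; apply/andP; split; lra. Qed.

Lemma norm_jump_le b b' : `|jump b b'| <= jbound.
Proof.
rewrite /jump /jbound normrM normfV.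
have l0 : 0 < 1 - lam by move: lam1; rewrite ltr_norml => /andP[? ?]; lra.
rewrite (gtr0_norm l0) ler_pM2r ?invr_gt0//.
rewrite (le_trans (ler_normB _ _))// normrM.
have := norm_centred_le b; have := norm_centred_le b'.
have := normr_ge0 (b%:R - p); have := normr_ge0 lam; move: lam1.
nra.
Qed.

Lemma trans_sum b : trans b true + trans b false = 1.
Proof. by rewrite /trans; ring. Qed.

Lemma sig2_ge0 : 0 <= sig2.
Proof.
case/andP: p01 => p0 p1; move: lam1; rewrite ltr_norml => /andP[? ?].
by rewrite /sig2 divr_ge0 ?mulr_ge0//; lra.
Qed.

(** Solves corr = c/2 + lam corr, where c = (1-2p) lam/(1-lam) is the coefficient of y in the
    conditional variance of a jump: a second Poisson equation. *)
Definition corr : R := (1 - 2 * p) * lam / (1 - lam) / (2 * (1 - lam)).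

(* One step of the chain multiplies the corrected characteristic function by
   [1 - tau^2 sig2 / 2] up to [O(tau^3)]; the corrector [corr] cancels the
   fluctuation of the conditional variance of the jumps. *)
Lemma one_step (tau u : R) b : `|tau| <= 1 ->
  `|trans b true * (cos (u + tau * jump b true) * (1 - corr * tau ^+ 2 * (true%:R - p)))
   + trans b false * (cos (u + tau * jump b false) * (1 - corr * tau ^+ 2 * (false%:R - p)))
   - (1 - tau ^+ 2 * sig2 / 2) * (cos u * (1 - corr * tau ^+ 2 * (b%:R - p)))|
  <= (jbound ^+ 3 + `|corr| * jbound + `|corr| * sig2) * `|tau| ^+ 3.
Proof.
move=> tau1.
set jt := jump b true; set jf := jump b false.
pose R1 d := cos (u + d) - cos u + d * sin u + d ^+ 2 / 2 * cos u.
pose R2 d := cos (u + d) - cos u.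
have R1le b' : `|R1 (tau * jump b b')| <= jbound ^+ 3 * `|tau| ^+ 3.
  apply: (le_trans (norm_cos_taylor2_le _ _)).
  by rewrite normrM exprMn mulrC ler_wpM2r ?exprn_ge0// lerXn2r ?nnegrE ?jbound_ge0 ?norm_jump_le.
have R2le b' : `|R2 (tau * jump b b')| <= jbound * `|tau|.
  by apply: (le_trans (norm_cosB_le _ _)); rewrite normrM mulrC ler_wpM2r// norm_jump_le.
(* The sine terms cancel because jumps are centred, and the tau^2 terms by the choice of [corr].
   What survives is the cubic remainder [R1], the first-order remainder [R2] already weighted by
   tau^2, and the tau^4 cross term of the right-hand product. *)
have -> : trans b true * (cos (u + tau * jt) * (1 - corr * tau ^+ 2 * (true%:R - p)))
   + trans b false * (cos (u + tau * jf) * (1 - corr * tau ^+ 2 * (false%:R - p)))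
   - (1 - tau ^+ 2 * sig2 / 2) * (cos u * (1 - corr * tau ^+ 2 * (b%:R - p))) =
  (trans b true * R1 (tau * jt) + trans b false * R1 (tau * jf))
  - corr * tau ^+ 2 * (trans b true * (1 - p) * R2 (tau * jt)
                     + trans b false * (- p) * R2 (tau * jf))
  - corr * sig2 * tau ^+ 4 / 2 * (b%:R - p) * cos u.
  rewrite /R1 /R2 /jt /jf /jump /corr /sig2 /trans; case: b {R1le R2le jt jf} => /=; field.
  - by [].
  - by [].
have q0 := trans01 b true; have q1 := trans01 b false; have qs := trans_sum b.
set t1 := trans b true in q0 qs *; set t2 := trans b false in q1 qs *.
have R1t := R1le true; have R1f := R1le false.
have R2t := R2le true; have R2f := R2le false.
rewrite -/jt -/jf in R1t R1f R2t R2f.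
have A1 : `|t1 * R1 (tau * jt) + t2 * R1 (tau * jf)| <= jbound ^+ 3 * `|tau| ^+ 3.
  rewrite (le_trans (ler_normD _ _))// !normrM (ger0_norm q0) (ger0_norm q1); nra.
have A2 : `|t1 * (1 - p) * R2 (tau * jt) + t2 * (- p) * R2 (tau * jf)| <= jbound * `|tau|.
  rewrite (le_trans (ler_normD _ _))// !normrM (ger0_norm q0) (ger0_norm q1) normrN.
  case/andP: p01 => p0 p1.
  rewrite (ger0_norm (ltW p0)) ger0_norm; last lra.
  have h1 : t1 * (1 - p) * `|R2 (tau * jt)| <= t1 * (jbound * `|tau|).
    rewrite -mulrA ler_wpM2l//.
    by rewrite (le_trans _ R2t)// ler_piMl//; lra.
  have h2 : t2 * p * `|R2 (tau * jf)| <= t2 * (jbound * `|tau|).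
    rewrite -mulrA ler_wpM2l//.
    by rewrite (le_trans _ R2f)// ler_piMl//; lra.
  by rewrite (le_trans (lerD h1 h2))// -mulrDl qs mul1r.
have A3 : `|(b%:R - p) * cos u| <= 1.
  by rewrite normrM mulr_ile1// ?norm_centred_le ?cos_max.
have t0 := normr_ge0 tau.
have B2 : `|corr * tau ^+ 2 * (t1 * (1 - p) * R2 (tau * jt) + t2 * (- p) * R2 (tau * jf))|
     <= `|corr| * jbound * `|tau| ^+ 3.
  rewrite normrM normrM normrX.
  have -> : `|corr| * jbound * `|tau| ^+ 3 = `|corr| * `|tau| ^+ 2 * (jbound * `|tau|) by ring.
  by rewrite ler_wpM2l// mulr_ge0// exprn_ge0.
have B3 : `|corr * sig2 * tau ^+ 4 / 2 * (b%:R - p) * cos u| <= `|corr| * sig2 * `|tau| ^+ 3.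
  rewrite -[_ * _ * cos u]mulrA normrM.
  apply: (@le_trans _ _ (`|corr * sig2 * tau ^+ 4 / 2| * 1)); first by rewrite ler_wpM2l.
  have -> : corr * sig2 * tau ^+ 4 / 2 = corr * (sig2 * (tau ^+ 3 * (tau / 2))) by ring.
  move: (sig2) sig2_ge0 (corr) => sg sg0 c; rewrite mulr1 (normrM c) (normrM sg) (normrM (tau ^+ 3)) (ger0_norm sg0) normrX.
  rewrite -[leRHS]mulrA; apply: ler_wpM2l => //; apply: ler_wpM2l => //.
  rewrite ler_piMr ?exprn_ge0// normrM normfV (@ger0_norm _ 2)//; lra.
rewrite (le_trans (ler_normB _ _))// (le_trans (lerD (ler_normB _ _) (lexx _)))//.
lra.
Qed.

(** * Characteristic function and second moment of the partial sums *)

Definition charf n (tau th : R) : R :=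
  path_mean n (fun s => cos (tau * csum s + th)).

Definition charf_corr n (tau th : R) : R :=
  path_mean n (fun s => cos (tau * mart s + th) * (1 - corr * tau ^+ 2 * cur s)).

Lemma norm_cur_le s : `|cur s| <= 1. Proof. exact: norm_centred_le. Qed.

(** The upper half comes from exp(-x)(1+x) <= exp(-x)exp(x) = 1. *)
Lemma expRN_taylor1 (x : R) : 0 <= x -> `|expR (- x) - (1 - x)| <= x ^+ 2.
Proof.
move=> x0; have e1 := expR_ge1Dx (- x); have e2 := expR_ge1Dx x.
rewrite ger0_norm; last lra.
have e3 : expR (- x) * (1 + x) <= 1.
  by rewrite -[leRHS](expRxMexpNx_1 x) mulrC ler_wpM2r ?expR_ge0.
nra.
Qed.

(** The first three terms are the constant of [one_step]; the last pays for replacing [1 - x] by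
    [expR (- x)]. *)
Definition step_cst : R :=
  jbound ^+ 3 + `|corr| * jbound + `|corr| * sig2 + sig2 ^+ 2 * (1 + `|corr|).

Lemma step_cst_ge0 : 0 <= step_cst.
Proof.
rewrite /step_cst; move: jbound jbound_ge0 sig2 sig2_ge0 => J J0 v v0.
by rewrite !addr_ge0 ?mulr_ge0 ?exprn_ge0 ?addr_ge0.
Qed.

Lemma norm_corrector_le (tau : R) s : `|tau| <= 1 ->
  `|corr * tau ^+ 2 * cur s| <= `|corr| * `|tau|.
Proof.
move=> tau1; rewrite -mulrA normrM ler_wpM2l// normrM normrX expr2 -mulrA.
by rewrite ler_piMr// mulr_ile1// norm_cur_le.
Qed.

(** The exponential is preferred to [1 - x] because it lies in ]0,1], so that errors are not
    amplified under iteration, and because its powers are exactly Gaussian factors. *)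
Lemma charf_corrS n (tau th : R) : `|tau| <= 1 ->
  `|charf_corr n.+1 tau th - expR (- (tau ^+ 2 * sig2 / 2)) * charf_corr n tau th|
  <= step_cst * `|tau| ^+ 3.
Proof.
move=> tau1; rewrite /charf_corr path_meanS -path_meanZ -path_meanB.
apply: norm_path_mean_le => s; set b := head false s.
set x := tau ^+ 2 * sig2 / 2; set m := (X in _ - expR _ * X).
have x0 : 0 <= x by rewrite /x divr_ge0// mulr_ge0 ?sqr_ge0 ?sig2_ge0.
have st := one_step tau (tau * mart s + th) b tau1.
rewrite -/x -/(cur s) -/m in st.
have m1 : `|m| <= 1 + `|corr|.
  rewrite /m normrM -[leRHS]mul1r ler_pM// ?cos_max//.
  rewrite (le_trans (ler_normB _ _))// normr1 lerD2l.
  by rewrite (le_trans (norm_corrector_le tau s tau1))// ler_piMr.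
have ex : `|(1 - x - expR (- x)) * m| <= sig2 ^+ 2 * (1 + `|corr|) * `|tau| ^+ 3.
  rewrite normrM mulrAC; apply: ler_pM => //.
  rewrite distrC (le_trans (expRN_taylor1 x x0))//.
  have -> : x ^+ 2 = sig2 ^+ 2 * (`|tau| ^+ 3 * (`|tau| / 4)).
    by rewrite /x -(real_normK (num_real tau)); field.
  rewrite ler_wpM2l ?sqr_ge0// ler_piMr ?exprn_ge0//.
  by move: tau1; lra.
rewrite !mart_cons -/b /cur /=.
have splitj j : tau * (mart s + j) + th = tau * mart s + th + tau * j by ring.
rewrite !splitj.
set A := trans b true * _ + trans b false * _ in st *.
have -> : A - expR (- x) * m = (A - (1 - x) * m) + (1 - x - expR (- x)) * m by ring.
rewrite (le_trans (ler_normD _ _))// (le_trans (lerD st ex))//.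
by rewrite /step_cst -mulrDl.
Qed.

(** The Poisson term inside the cosine and the corrector are both boundary effects of order tau,
    uniformly in [n]. *)
Lemma norm_charf_corrB n (tau th : R) : `|tau| <= 1 ->
  `|charf_corr n tau th - charf n tau th| <= (jbound + `|corr|) * `|tau|.
Proof.
move=> tau1; rewrite /charf_corr /charf -path_meanB.
apply: norm_path_mean_le => s.
have -> : cos (tau * mart s + th) * (1 - corr * tau ^+ 2 * cur s) - cos (tau * csum s + th) =
  (cos ((tau * csum s + th) + tau * (lam / (1 - lam) * cur s)) - cos (tau * csum s + th))
  - cos (tau * mart s + th) * (corr * tau ^+ 2 * cur s).
  have -> : (tau * csum s + th) + tau * (lam / (1 - lam) * cur s) = tau * mart s + th.
    by rewrite /mart; ring.
  by ring.
rewrite (le_trans (ler_normB _ _))// mulrDl lerD//.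
  rewrite (le_trans (norm_cosB_le _ _))// normrM mulrC ler_wpM2r//.
  have l0 : 0 < 1 - lam by move: lam1; rewrite ltr_norml => /andP[? ?]; lra.
  rewrite normrM normrM normfV (gtr0_norm l0) /jbound mulrAC ler_pM2r ?invr_gt0//.
  apply: (@le_trans _ _ 1); last lra.
  by rewrite mulr_ile1 ?norm_cur_le// ltW.
rewrite normrM (le_trans _ (norm_corrector_le tau s tau1))//.
by rewrite ler_piMl// cos_max.
Qed.

Lemma norm_charf0B (tau th : R) : `|charf 0 tau th - cos th| <= `|tau|.
Proof.
rewrite -[X in _ - X](path_mean_cst 0) /charf -path_meanB.
have h (b : bool) : `|cos (tau * csum [:: b] + th) - cos th| <= `|tau|.
  rewrite (addrC _ th) (le_trans (norm_cosB_le _ _))// normrM ler_piMr//.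
  by rewrite /csum big_seq1 norm_centred_le.
rewrite path_mean0 (le_trans (ler_normD _ _))// !normrM.
have := h true; have := h false; case/andP: p01 => p0 p1.
rewrite (gtr0_norm p0) (@gtr0_norm _ (1 - p)); last lra.
nra.
Qed.

Lemma charf_corr_iter n (tau th : R) : `|tau| <= 1 ->
  `|charf_corr n tau th - expR (- (tau ^+ 2 * sig2 / 2)) ^+ n * charf_corr 0 tau th|
  <= n%:R * (step_cst * `|tau| ^+ 3).
Proof.
move=> tau1; set rho := expR _.
have rho1 : rho <= 1.
  by rewrite -expR0 ler_expR oppr_le0 divr_ge0// mulr_ge0 ?sqr_ge0 ?sig2_ge0.
elim: n => [|n ih]; first by rewrite expr0 mul1r subrr normr0 mul0r.
have -> : charf_corr n.+1 tau th - rho ^+ n.+1 * charf_corr 0 tau th =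
  (charf_corr n.+1 tau th - rho * charf_corr n tau th)
  + rho * (charf_corr n tau th - rho ^+ n * charf_corr 0 tau th) by rewrite exprS; ring.
rewrite (le_trans (ler_normD _ _))// -natr1 mulrDl mul1r addrC lerD//.
  rewrite normrM (le_trans _ ih)// ler_piMl//.
  by rewrite ger0_norm ?expR_ge0.
exact: charf_corrS.
Qed.

Lemma charf_rate (t th : R) : exists K : R, forall n,
  `|charf n (t / Num.sqrt n.+1%:R) th - expR (- (t ^+ 2 * sig2 / 2)) * cos th|
  <= K / Num.sqrt n.+1%:R.
Proof.
pose J := jbound + `|corr|.
have J0 : 0 <= J by rewrite addr_ge0// jbound_ge0.
pose K := J + (t ^+ 2 * step_cst + (J + 1) + sig2).
(* The [+ 2] covers the range |tau| > 1, where both quantities are bounded by 1 and no expansion is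
   used. *)
exists ((K + 2) * `|t|) => n.
set N : R := n.+1%:R; set tau := t / _.
have N0 : 0 < N by rewrite ltr0n.
have sN0 : 0 < Num.sqrt N by rewrite sqrtr_gt0.
have tauE : `|t| / Num.sqrt N = `|tau| by rewrite /tau normrM normfV (gtr0_norm sN0).
rewrite -[leRHS]mulrA tauE.
have K0 : 0 <= K.
  have := mulr_ge0 (sqr_ge0 t) step_cst_ge0; have := sig2_ge0.
  by rewrite /K; lra.
have tau2 : N * tau ^+ 2 = t ^+ 2.
  by rewrite /tau exprMn exprVn sqr_sqrtr ?(ltW N0)//; field; rewrite gt_eqF.
have ex1 : expR (- (t ^+ 2 * sig2 / 2)) <= 1.
  by rewrite -expR0 ler_expR oppr_le0 divr_ge0// mulr_ge0 ?sqr_ge0 ?sig2_ge0.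
have [tau1|/ltW tau1] := leP `|tau| 1; last first.
  have B : `|charf n tau th| <= 1 by apply: norm_path_mean_le => s; exact: cos_max.
  have C : `|expR (- (t ^+ 2 * sig2 / 2)) * cos th| <= 1.
    by rewrite normrM mulr_ile1 ?cos_max// ger0_norm ?expR_ge0.
  rewrite (le_trans (ler_normB _ _))// (le_trans (lerD B C))//.
  have := mulr_ge0 K0 (normr_ge0 tau); rewrite (mulrDl K 2); lra.
set rho := expR (- (tau ^+ 2 * sig2 / 2)).
have rho0 : 0 <= rho by exact: expR_ge0.
have rho1 : rho <= 1.
  by rewrite -expR0 ler_expR oppr_le0 divr_ge0// mulr_ge0 ?sqr_ge0 ?sig2_ge0.
have rhon1 : rho ^+ n <= 1 by rewrite exprn_ile1.
have rhon0 : 0 <= rho ^+ n by rewrite exprn_ge0.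
have rhoN : expR (- (t ^+ 2 * sig2 / 2)) = rho ^+ n.+1.
  by rewrite /rho -expRM_natl -tau2 -/N; congr expR; rewrite mulrN; ring.
have D1 := norm_charf_corrB n tau th tau1.
have D2 := charf_corr_iter n tau th tau1.
have D3 := norm_charf_corrB 0 tau th tau1.
have D4 := norm_charf0B tau th.
have D5 : 1 - rho <= sig2 * `|tau|.
  have := expR_ge1Dx (- (tau ^+ 2 * sig2 / 2)); rewrite -/rho.
  have : tau ^+ 2 * sig2 / 2 <= sig2 * `|tau|.
    rewrite mulrC mulrA -(real_normK (num_real tau)) [leRHS]mulrC.
    have -> : 2^-1 * `|tau| ^+ 2 * sig2 = `|tau| * sig2 * (`|tau| / 2) by ring.
    by apply: ler_piMr; [apply: mulr_ge0 => //; exact: sig2_ge0 | lra].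
  lra.
have D2' : n%:R * (step_cst * `|tau| ^+ 3) <= t ^+ 2 * step_cst * `|tau|.
  rewrite -tau2 -(real_normK (num_real tau)).
  have -> : N * `|tau| ^+ 2 * step_cst * `|tau| = N * (step_cst * `|tau| ^+ 3) by ring.
  by rewrite ler_wpM2r ?mulr_ge0 ?step_cst_ge0 ?exprn_ge0// ler_nat.
(* There are only [n] transitions among [n.+1] states, so the iteration yields [rho ^+ n] while the
   limit equals [rho ^+ n.+1]; the last term pays for the missing factor. *)
have E : charf n tau th - rho ^+ n.+1 * cos th =
  - (charf_corr n tau th - charf n tau th)
  + (charf_corr n tau th - rho ^+ n * charf_corr 0 tau th)
  + rho ^+ n * (charf_corr 0 tau th - charf 0 tau th)
  + rho ^+ n * (charf 0 tau th - cos th)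
  + rho ^+ n * cos th * (1 - rho) by rewrite exprSr; ring.
have contract (z k : R) : `|z| <= k -> `|rho ^+ n * z| <= k.
  move=> zk; rewrite normrM (le_trans _ zk)// ler_piMl// ger0_norm//.
have D5' : `|rho ^+ n * cos th * (1 - rho)| <= sig2 * `|tau|.
  rewrite normrM [X in _ * X]ger0_norm; last lra.
  rewrite (le_trans _ D5)// ler_piMl//; first by lra.
  by rewrite contract// cos_max.
rewrite rhoN E.
have norm5 (x y z w v : R) : `|- x + y + z + w + v| <= `|x| + `|y| + `|z| + `|w| + `|v|.
  by do 3! rewrite (le_trans (ler_normD _ _))// lerD2r; rewrite -(normrN x) ler_normD.
apply: (le_trans (norm5 _ _ _ _ _)).
have -> : (K + 2) * `|tau| = J * `|tau| + t ^+ 2 * step_cst * `|tau|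
    + J * `|tau| + `|tau| + sig2 * `|tau| + 2 * `|tau| by rewrite /K; ring.
rewrite -[leLHS]addr0 lerD ?mulr_ge0//.
rewrite lerD// lerD ?contract// lerD ?contract// lerD//.
exact: (le_trans D2).
Qed.

(** Martingale increments are orthogonal: the cross term vanishes because jumps are centred given
    the current state, so each step adds at most [jbound ^+ 2]. *)
Lemma path_mean_mart_sqr_le n : path_mean n (fun s => mart s ^+ 2) <= n.+1%:R * jbound ^+ 2.
Proof.
have jsq b b' : jump b b' ^+ 2 <= jbound ^+ 2.
  by rewrite -(real_normK (num_real (jump b b'))) lerXn2r ?nnegrE ?jbound_ge0 ?norm_jump_le.
elim: n => [|n ih].
  have h (b : bool) : mart [:: b] ^+ 2 <= jbound ^+ 2.
    rewrite mart_cons.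
    have -> : mart [::] + jump (head false [::]) b = (b%:R - p) / (1 - lam).
      by rewrite /mart /jump /csum /cur big_nil /=; field.
    rewrite /jbound !exprMn ler_pM2r ?exprn_even_gt0 ?invr_eq0//.
    rewrite -(real_normK (num_real _)) lerXn2r ?nnegrE//.
    by rewrite (le_trans (norm_centred_le b))//; lra.
  rewrite path_mean0 mul1r; have := h true; have := h false.
  by case/andP: p01 => *; nra.
rewrite path_meanS -natr1 mulrDl mul1r.
apply: le_trans (lerD ih (lexx _)).
rewrite -[X in _ + X](path_mean_cst n) -path_meanD.
apply: le_path_mean => s; rewrite !mart_cons; set b := head false s.
have zero : trans b true * jump b true + trans b false * jump b false = 0.
  by rewrite /trans /jump; case: b => /=; field.
have q0 := trans01 b true; have q1 := trans01 b false; have qs := trans_sum b.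
have := jsq b true; have := jsq b false.
move: (jump b true) (jump b false) (trans b true) (trans b false) zero q0 q1 qs => j1 j2 q r zero q0 q1 qs h2 h1.
have -> : q * (mart s + j1) ^+ 2 + r * (mart s + j2) ^+ 2 =
  (q + r) * mart s ^+ 2 + 2 * mart s * (q * j1 + r * j2) + (q * j1 ^+ 2 + r * j2 ^+ 2) by ring.
rewrite qs zero mul1r mulr0 addr0 lerD2l.
rewrite -[leRHS]mul1r -qs mulrDl lerD// ler_wpM2l//.
Qed.

Lemma path_mean_csum_sqr_le n :
  path_mean n (fun s => csum s ^+ 2) <= n.+1%:R * (4 * jbound ^+ 2).
Proof.
apply: (@le_trans _ _ (path_mean n (fun s => 2 * mart s ^+ 2 + 2 * jbound ^+ 2))).
  apply: le_path_mean => s.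
  have -> : csum s = mart s - lam / (1 - lam) * cur s by rewrite /mart; ring.
  set z := lam / (1 - lam) * cur s.
  have zj : z ^+ 2 <= jbound ^+ 2.
    rewrite /z /jbound mulrAC !exprMn ler_pM2r ?exprn_even_gt0 ?invr_eq0//.
    rewrite -exprMn -(real_normK (num_real _)) lerXn2r ?nnegrE//.
    rewrite normrM; apply: (@le_trans _ _ 1); last lra.
    by rewrite mulr_ile1 ?norm_cur_le// ltW.
  by have := sqr_ge0 (mart s + z); lra.
rewrite path_meanD path_meanZ path_mean_cst.
have := path_mean_mart_sqr_le n.
have : jbound ^+ 2 <= n.+1%:R * jbound ^+ 2 by rewrite ler_peMl ?sqr_ge0// ler1n.
lra.
Qed.

End two_state_chain.

(** * The Gaussian side *)

Section gaussian.
Context {R : realType} (s : R).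
Hypothesis s0 : s != 0.
Local Notation mu := (@lebesgue_measure R).
Local Notation N := (normal_pdf 0 s).

Let s2 : R := Num.sqrt 2 * s.

Let s2_neq0 : s2 != 0.
Proof. by rewrite mulf_neq0// gt_eqF// sqrtr_gt0. Qed.

Lemma normal_pdf0E x : N x = normal_peak s * expR (- x ^+ 2 / (2 * s ^+ 2)).
Proof. by rewrite (normal_pdfE _ s0) /normal_fun subr0 mulr_natl. Qed.

Let ss_gt0 : 0 < s ^+ 2.
Proof. by rewrite exprn_even_gt0. Qed.

Lemma is_derive_normal_pdf x : is_derive x (1 : R) N (- (x / s ^+ 2) * N x).
Proof.
have -> : N = (fun x => normal_peak s * expR (- x ^+ 2 / (2 * s ^+ 2))).
  by apply/funext => y; rewrite normal_pdf0E.
apply: is_derive_eq; rewrite /GRing.scale /=.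
by field.
Qed.

(** Dominated by a multiple of the density of doubled variance: with u = x^2/(4s^2), the bound u
    exp(-u) <= 1 absorbs the factor x^2 into one of the two factors exp(-u). *)
Lemma integrable_sqr_normal_pdf :
  mu.-integrable setT (EFin \o (fun x => x ^+ 2 * N x)).
Proof.
pose C := 4 * s ^+ 2 * normal_peak s / normal_peak s2.
have ig : mu.-integrable setT (EFin \o (fun x => C * normal_pdf 0 s2 x)).
  exact: (integrableZl measurableT C (integrable_normal_pdf 0 s2)).
apply: le_integrable ig => //.
  apply/measurable_EFinP; apply: measurable_funM; last exact: measurable_normal_pdf.
  exact: measurable_funX.
move=> x _; rewrite lee_fin.
have C0 : 0 <= C.
  by rewrite divr_ge0 ?normal_peak_ge0// mulr_ge0 ?normal_peak_ge0// mulr_ge0 ?sqr_ge0.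
have pk2 := normal_peak_gt0 s2_neq0; have pk := normal_peak_gt0 s0.
rewrite ger0_norm; last exact: mulr_ge0 (sqr_ge0 _) (normal_pdf_ge0 _ _ _).
rewrite ger0_norm; last exact: mulr_ge0 C0 (normal_pdf_ge0 _ _ _).
have -> : normal_pdf 0 s2 x = normal_peak s2 * expR (- (x ^+ 2 / (4 * s ^+ 2))).
  have s2E : s2 ^+ 2 *+ 2 = 4 * s ^+ 2 by rewrite exprMn sqr_sqrtr//; ring.
  by rewrite (normal_pdfE _ s2_neq0) /normal_fun subr0 s2E mulNr.
rewrite normal_pdf0E.
have -> : - x ^+ 2 / (2 * s ^+ 2) = - (x ^+ 2 / (4 * s ^+ 2)) + - (x ^+ 2 / (4 * s ^+ 2)).
  by field.
rewrite expRD; set u := x ^+ 2 / (4 * s ^+ 2).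
have -> : x ^+ 2 = 4 * s ^+ 2 * u by rewrite /u; field.
have u0 : 0 <= u.
  by apply: divr_ge0; [exact: sqr_ge0|apply: mulr_ge0 => //; exact: sqr_ge0].
have ue : u * expR (- u) <= 1.
  rewrite -[leRHS](expRxMexpNx_1 u) ler_wpM2r ?expR_ge0//.
  by rewrite (le_trans _ (expR_ge1Dx u))// lerDr.
have -> : 4 * s ^+ 2 * u * (normal_peak s * (expR (- u) * expR (- u))) =
   C * (normal_peak s2 * expR (- u)) * (u * expR (- u)).
  by rewrite /C; field; rewrite gt_eqF.
apply: ler_piMr => //; apply: mulr_ge0 => //.
exact: mulr_ge0 (ltW pk2) (expR_ge0 _).
Qed.

Lemma integrable_normal_pdfM (h : R -> R) (K : R) : measurable_fun setT h ->
  (forall x, `|h x| <= K * (1 + x ^+ 2)) ->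
  mu.-integrable setT (EFin \o (fun x => h x * N x)).
Proof.
move=> mh hK.
have ig : mu.-integrable setT (EFin \o (fun x => K * (N x + x ^+ 2 * N x))).
  have iD := integrableD measurableT (integrable_normal_pdf 0 s) integrable_sqr_normal_pdf.
  exact: (integrableZl measurableT K iD).
apply: le_integrable ig => //.
  by apply/measurable_EFinP; apply: measurable_funM => //; exact: measurable_normal_pdf.
move=> x _; rewrite lee_fin normrM (ger0_norm (normal_pdf_ge0 _ _ _)).
rewrite (le_trans _ (ler_norm _))//.
have -> : K * (N x + x ^+ 2 * N x) = K * (1 + x ^+ 2) * N x by ring.
by rewrite ler_wpM2r// normal_pdf_ge0.
Qed.

Lemma cvg_normal_pdf0 : N n.+1%:R @[n --> \oo] --> 0.
Proof.
pose C := normal_peak s * (2 * s ^+ 2).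
apply: (@squeeze_cvgr _ _ _ _ (cst 0) (fun n : nat => C * n.+1%:R^-1)).
- apply: nearW => n.
  have nR : 0 < n.+1%:R :> R by rewrite ltr0n.
  rewrite normal_pdf_ge0 normal_pdf0E /C -mulrA ler_wpM2l ?(ltW (normal_peak_gt0 s0))//.
  set u := n.+1%:R ^+ 2 / (2 * s ^+ 2).
  rewrite mulNr -/u.
  have u0 : 0 < u.
    by apply: divr_gt0; [exact: exprn_gt0|exact: mulr_gt0].
  have ue : u * expR (- u) <= 1.
    rewrite -[leRHS](expRxMexpNx_1 u) ler_wpM2r ?expR_ge0//.
    by rewrite (le_trans _ (expR_ge1Dx u))// lerDr.
  apply: (@le_trans _ _ (u^-1)); first by rewrite -div1r ler_pdivlMr// mulrC.
  rewrite /u invf_div ler_wpM2l//; first by rewrite ltW// mulr_gt0.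
  by rewrite expr2 lef_pV2 ?posrE ?mulr_gt0// ler_peMl ?(ltW nR)// ler1n.
- exact: cvg_cst.
- by rewrite -[X in _ --> X](mulr0 C); apply: cvgMl_tmp; exact: cvg_harmonic.
Qed.

(** Integration by parts on the line with vanishing boundary terms: the fundamental theorem on
    [-(n+1), n+1], then dominated convergence with |g| as the bound. *)
Lemma Rintegral_deriv0 (G g : R -> R) :
  (forall x, is_derive x (1 : R) G (g x)) -> continuous g ->
  mu.-integrable setT (EFin \o g) ->
  (G n.+1%:R @[n --> \oo] --> 0) -> (G (- n.+1%:R) @[n --> \oo] --> 0) ->
  \int[mu]_x g x = 0.
Proof.
move=> Gg gc ig Gp Gm.
have Gc : continuous G by move=> z; apply/differentiable_continuous/derivable1_diffP.
have mg : measurable_fun setT g by exact: continuous_measurable_fun.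
pose I (n : nat) : set R := [set` `[- n.+1%:R, n.+1%:R]].
have ftc (n : nat) : (\int[mu]_(x in I n) (g x)%:E
    = (G n.+1%:R%R)%:E - (G (- n.+1%:R)%R)%:E)%E.
  apply: continuous_FTC2.
  - by rewrite (@lt_trans _ _ 0)// ?oppr_lt0 ltr0n.
  - exact: continuous_subspaceT.
  - split; first by move=> x _; exact: ex_derive.
    + by apply: cvg_at_right_filter; exact: Gc.
    + by apply: cvg_at_left_filter; exact: Gc.
  - by move=> x _; rewrite derive1E derive_val.
pose f_ (n : nat) := (EFin \o g) \_ (I n).
have [_ _] : [/\ mu.-integrable setT (EFin \o g),
    (\int[mu]_x `|f_ n x - (EFin \o g) x|)%E @[n --> \oo] --> 0%E
  & (\int[mu]_x f_ n x)%E @[n --> \oo] --> (\int[mu]_x (EFin \o g) x)%E].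
  apply: (@dominated_convergence _ _ _ mu setT measurableT f_ (EFin \o g)
     (fun x => `|(EFin \o g) x|%E)).
  - move=> n; apply/(measurable_restrictT _ _).1; first exact: measurable_itv.
    by apply/measurable_EFinP; exact: measurable_funTS.
  - exact/measurable_EFinP.
  - apply: aeW => x _; apply: cvg_near_cst.
    exists (Num.truncn `|x|) => // n /= xn.
    have xI : x \in I n.
      rewrite inE /I /= in_itv/= -ler_norml (le_trans (ltW (truncnS_gt _)))//.
      by rewrite ler_nat ltnS.
    by rewrite /f_ patchE xI.
  - exact: integrable_abse.
  - apply: aeW => x n _; rewrite /f_ patchE; case: ifP => // _.
    by rewrite abse0 abse_ge0.
rewrite -[X in _ --> X -> _]fineK; last exact: integrable_fin_num.
have -> : (fun n => (\int[mu]_x f_ n x)%E) = EFin \o (fun n : nat => G n.+1%:R - G (- n.+1%:R)).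
  by apply/funext => n; rewrite /f_ -integral_mkcond ftc.
move=> /fine_cvgP[_]; rewrite /comp /= => h.
have h0 : G n.+1%:R - G (- n.+1%:R) @[n --> \oo] --> 0.
  by rewrite -[X in _ --> X](subr0 0); exact: cvgB.
exact: (cvg_unique _ h h0).
Qed.

Definition normal_mean (h : R -> R) : R := \int[mu]_x (h x * N x).

Let abs_le_sqr (x : R) : `|x| <= 1 * (1 + x ^+ 2).
Proof.
rewrite -(real_normK (num_real x)); move: (`|x|) (normr_ge0 x) => y y0.
have := sqr_ge0 (y - 1); lra.
Qed.

Let integrable_cos (t th : R) :
  mu.-integrable setT (EFin \o (fun x => cos (t * x + th) * N x)).
Proof.
apply: (@integrable_normal_pdfM (fun x => cos (t * x + th)) 1).
- apply: continuous_measurable_fun => x.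
  by apply/differentiable_continuous/derivable1_diffP; exact: ex_derive.
- by move=> x; rewrite (le_trans (cos_max _))// mul1r lerDl sqr_ge0.
Qed.

Let integrable_xsin (t th : R) :
  mu.-integrable setT (EFin \o (fun x => - x * sin (t * x + th) * N x)).
Proof.
apply: (@integrable_normal_pdfM (fun x => - x * sin (t * x + th)) 1).
- apply: continuous_measurable_fun => x.
  by apply/differentiable_continuous/derivable1_diffP; exact: ex_derive.
- move=> x; rewrite normrM normrN (le_trans _ (abs_le_sqr x))//.
  by rewrite ler_piMr// sin_max.
Qed.

(** Stein's identity, obtained by integrating the derivative of sin(tx+th) N(x). It closes the
    differential equation in [t]. *)
Lemma normal_mean_xsin (t th : R) :
  normal_mean (fun x => - x * sin (t * x + th))
  = - (s ^+ 2 * t) * normal_mean (fun x => cos (t * x + th)).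
Proof.
pose g x := t * (cos (t * x + th) * N x)
  + (s ^+ 2)^-1 * (- x * sin (t * x + th) * N x).
have sin_bound x : `|sin (t * x + th) * N x| <= N x.
  by rewrite normrM (ger0_norm (normal_pdf_ge0 _ _ _)) ler_piMl ?normal_pdf_ge0 ?sin_max.
have sin0 (u : nat -> R) : (N (u n) @[n --> \oo] --> 0) ->
    sin (t * u n + th) * N (u n) @[n --> \oo] --> 0.
  move=> Nu; apply: norm_cvg0.
  apply: (@squeeze_cvgr _ _ _ _ (cst 0) (fun n : nat => N (u n))) => //.
    by apply: nearW => n; rewrite normr_ge0 sin_bound.
  exact: cvg_cst.
have : \int[mu]_x g x = 0.
  apply: (@Rintegral_deriv0 (fun x => sin (t * x + th) * N x)).
  - move=> x; have dN := is_derive_normal_pdf x.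
    apply: is_derive_eq; rewrite /GRing.scale /= /g.
    by field.
  - move=> x; have dN := is_derive_normal_pdf x.
    by apply/differentiable_continuous/derivable1_diffP; exact: ex_derive.
  - exact: (integrableD measurableT
      (integrableZl measurableT t (integrable_cos t th))
      (integrableZl measurableT (s ^+ 2)^-1 (integrable_xsin t th))).
  - exact: (sin0 (fun n => n.+1%:R) cvg_normal_pdf0).
  - apply: (sin0 (fun n => - n.+1%:R)).
    under eq_fun do rewrite normal_pdf0E sqrrN -normal_pdf0E.
    exact: cvg_normal_pdf0.
rewrite /g RintegralD//; last 2 first.
- exact: (integrableZl measurableT t (integrable_cos t th)).
- exact: (integrableZl measurableT _ (integrable_xsin t th)).
rewrite !RintegralZl// /normal_mean.
set A := (X in t * X); set B := (X in _ + _ * X) => h; rewrite -/A -/B.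
have -> : B = s ^+ 2 * (t * A + (s ^+ 2)^-1 * B) - s ^+ 2 * t * A by field.
by rewrite h; ring.
Qed.

(** The bound (1+x^2) N(x) on the partial derivative does not depend on [t], so any window around
    [t] would do. *)
Let is_derive_normal_charf (t th : R) :
  is_derive t (1 : R) (fun t => normal_mean (fun x => cos (t * x + th)))
    (normal_mean (fun x => - x * sin (t * x + th))).
Proof.
pose f (t x : R) := cos (t * x + th) * N x.
have df (u x : R) : is_derive u (1 : R) (f^~ x) (- x * sin (u * x + th) * N x).
  by apply: is_derive_eq; rewrite /GRing.scale /=; ring.
have It : [set` `](t - 1), (t + 1)[] t.
  by rewrite /= in_itv/= ltrBlDr ltrDl ltr01.
pose G x := (1 + x ^+ 2) * N x.
have G0 x : 0 <= G x by rewrite mulr_ge0 ?normal_pdf_ge0// addr_ge0 ?sqr_ge0.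
have iG : mu.-integrable setT (EFin \o G).
  apply: (@integrable_normal_pdfM (fun x => 1 + x ^+ 2) 1).
  - apply: continuous_measurable_fun => x.
  by apply/differentiable_continuous/derivable1_diffP; exact: ex_derive.
  - by move=> x; rewrite mul1r ger0_norm// addr_ge0 ?sqr_ge0.
have pE (u x : R) : partial1of2 f u x = - x * sin (u * x + th) * N x.
  by rewrite partial1of2E derive_val.
have dG u x : [set` `](t - 1), (t + 1)[] u -> setT x -> `|partial1of2 f u x| <= G x.
  move=> _ _; rewrite pE /G normrM (ger0_norm (normal_pdf_ge0 _ _ _)).
  rewrite ler_wpM2r ?normal_pdf_ge0// normrM normrN -[leRHS]mul1r.
  by rewrite (le_trans _ (abs_le_sqr x))// ler_piMr// sin_max.
have intf u : [set` `](t - 1), (t + 1)[] u -> mu.-integrable setT (EFin \o f u).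
  by move=> _; exact: integrable_cos.
have derf u x : [set` `](t - 1), (t + 1)[] u -> setT x -> derivable (f^~ x) u 1.
  by move=> _ _; exact: ex_derive.
apply: DeriveDef.
  exact: (derivable_under_integral measurableT It intf derf G0 iG dG).
rewrite -derive1E.
rewrite (differentiation_under_integral measurableT It intf derf G0 iG dG).
by apply: eq_Rintegral => x _; rewrite pE.
Qed.

(** Multiplying by the integrating factor exp(t^2 s^2/2) gives a function of zero derivative,
    evaluated at t = 0. *)
Lemma normal_mean_cos (t th : R) :
  normal_mean (fun x => cos (t * x + th)) = expR (- (t ^+ 2 * s ^+ 2 / 2)) * cos th.
Proof.
pose psi (t : R) := normal_mean (fun x => cos (t * x + th)) * expR (t ^+ 2 * s ^+ 2 / 2).
have dpsi (u : R) : is_derive u (1 : R) psi 0.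
  have d1 := is_derive_normal_charf u th.
  rewrite normal_mean_xsin in d1.
  apply: is_derive_eq; rewrite /GRing.scale /=.
  by field.
have psi0 : psi 0 = cos th.
  rewrite /psi expr0n/= mul0r mul0r expR0 mulr1 /normal_mean.
  under eq_Rintegral do rewrite mul0r add0r.
  rewrite RintegralZl//; last exact: integrable_normal_pdf.
  by rewrite /Rintegral integral_normal_pdf mulr1.
rewrite -psi0 -(is_derive_0_is_cst t 0 dpsi) /psi.
by rewrite mulrCA [X in _ = _ * X]mulrC expRxMexpNx_1 mulr1.
Qed.

Lemma integrable_bounded (h : R -> R) (K : R) : measurable_fun setT h ->
  (forall x, `|h x| <= K) -> mu.-integrable setT (EFin \o (fun x => h x * N x)).
Proof.
move=> mh hK; apply: (@integrable_normal_pdfM h K mh) => x.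
by rewrite (le_trans (hK x))// ler_peMr ?(le_trans _ (hK 0))// lerDl sqr_ge0.
Qed.

Lemma normal_mean_le_sqr (h g : R -> R) (K e k : R) :
  measurable_fun setT h -> measurable_fun setT g ->
  (forall x, `|h x| <= K) -> (forall x, `|g x| <= K) ->
  (forall x, h x <= g x + e + k * x ^+ 2) ->
  normal_mean h <= normal_mean g + e + k * normal_mean (fun x => x ^+ 2).
Proof.
move=> mh mg hK gK hg.
have ih := @integrable_bounded h K mh hK.
have ig := @integrable_bounded g K mg gK.
have ie := integrableZl measurableT e (integrable_normal_pdf 0 s).
have ik := integrableZl measurableT k integrable_sqr_normal_pdf.
have -> : normal_mean g + e + k * normal_mean (fun x => x ^+ 2) =
    \int[mu]_x (g x * N x + e * N x + k * (x ^+ 2 * N x)).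
  rewrite RintegralD//; last exact: (integrableD measurableT ig ie).
  rewrite RintegralD// !RintegralZl//; last 2 first.
  - exact: integrable_sqr_normal_pdf.
  - exact: integrable_normal_pdf.
  by congr (_ + _ + _); rewrite /Rintegral integral_normal_pdf mulr1.
apply: le_Rintegral => //.
  exact: (integrableD measurableT (integrableD measurableT ig ie) ik).
move=> x _.
have -> : g x * N x + e * N x + k * (x ^+ 2 * N x) = (g x + e + k * x ^+ 2) * N x by ring.
by rewrite ler_wpM2r ?normal_pdf_ge0.
Qed.

Lemma normal_meanD (h g : R -> R) (K : R) :
  measurable_fun setT h -> measurable_fun setT g ->
  (forall x, `|h x| <= K) -> (forall x, `|g x| <= K) ->
  normal_mean (fun x => h x + g x) = normal_mean h + normal_mean g.
Proof.
move=> mh mg hK gK; rewrite /normal_mean.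
under eq_Rintegral do rewrite mulrDl.
by rewrite RintegralD//; exact: integrable_bounded.
Qed.

Lemma normal_meanZ (k : R) (h : R -> R) (K : R) :
  measurable_fun setT h -> (forall x, `|h x| <= K) ->
  normal_mean (fun x => k * h x) = k * normal_mean h.
Proof.
move=> mh hK; rewrite /normal_mean.
under eq_Rintegral do rewrite -mulrA.
by rewrite RintegralZl//; exact: integrable_bounded.
Qed.

Lemma normal_mean_cdf (c : R) :
  normal_mean (fun x => (x <= c)%R%:R) = fine (normal_prob 0 s [set` `]-oo, c]]).
Proof.
rewrite /normal_mean /normal_prob -/(Rintegral _ _ _) [RHS]Rintegral_mkcond.
apply: eq_Rintegral => x _; rewrite patchE.
have -> : (x \in [set` `]-oo, c]]) = (x <= c).
  by apply/idP/idP; rewrite inE /= in_itv.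
by case: (x <= c); rewrite ?mul1r ?mul0r.
Qed.

End gaussian.

(** * Trigonometric approximation of half-lines *)

Section trigonometric_steps.
Context {R : realType}.

(** Frequencies are arbitrary reals. The phase brings in the sines and lets the product-to-sum
    formula stay within the class. *)
Inductive trigpoly : (R -> R) -> Prop :=
| trigpoly_cos c t th : trigpoly (fun x => c * cos (t * x + th))
| trigpoly_add f g : trigpoly f -> trigpoly g -> trigpoly (fun x => f x + g x).

Lemma trigpoly_ext (f g : R -> R) : trigpoly f -> f =1 g -> trigpoly g.
Proof. by move=> tf /funext <-. Qed.

Lemma trigpoly_cst (c : R) : trigpoly (fun=> c).
Proof.
by apply: trigpoly_ext (trigpoly_cos c 0 0) _ => x; rewrite mul0r addr0 cos0 mulr1.
Qed.

Lemma cosM_half (u v : R) : cos u * cos v = 2^-1 * cos (u + v) + 2^-1 * cos (u - v).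
Proof. by rewrite cosD cosB; field. Qed.

Lemma trigpoly_mul (f g : R -> R) : trigpoly f -> trigpoly g ->
  trigpoly (fun x => f x * g x).
Proof.
elim=> [c t th|f1 f2 _ ih1 _ ih2] tg; last first.
  by apply: trigpoly_ext (trigpoly_add _ _ (ih1 tg) (ih2 tg)) _ => x; rewrite mulrDl.
elim: tg => [c' t' th'|g1 g2 _ ih1 _ ih2]; last first.
  by apply: trigpoly_ext (trigpoly_add _ _ ih1 ih2) _ => x; rewrite mulrDr.
apply: trigpoly_ext (trigpoly_add _ _
  (trigpoly_cos (c * c' / 2) (t + t') (th + th'))
  (trigpoly_cos (c * c' / 2) (t - t') (th - th'))) _ => x.
rewrite mulrACA cosM_half mulrDr !mulrA.
by congr (_ * cos _ + _ * cos _); ring.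
Qed.

Lemma trigpoly_exp (f : R -> R) n : trigpoly f -> trigpoly (fun x => f x ^+ n).
Proof.
move=> tf; elim: n => [|n ih]; first exact: trigpoly_cst.
by apply: trigpoly_ext (trigpoly_mul _ _ tf ih) _ => x; rewrite exprS.
Qed.

Lemma trigpoly_onem (f : R -> R) : trigpoly f -> trigpoly (fun x => 1 - f x).
Proof.
move=> tf; apply: trigpoly_ext
  (trigpoly_add _ _ (trigpoly_cst 1) (trigpoly_mul _ _ (trigpoly_cst (-1)) tf)) _ => x.
by rewrite mulN1r.
Qed.

Lemma trigpoly_measurable_bounded (f : R -> R) : trigpoly f ->
  measurable_fun setT f /\ exists K, forall x, `|f x| <= K.
Proof.
elim=> [c t th|f1 f2 _ [m1 [K1 b1]] _ [m2 [K2 b2]]].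
  split.
    apply: continuous_measurable_fun => x.
    by apply/differentiable_continuous/derivable1_diffP; exact: ex_derive.
  by exists `|c| => x; rewrite normrM ler_piMr// cos_max.
split; first exact: measurable_funD.
by exists (K1 + K2) => x; rewrite (le_trans (ler_normD _ _))// lerD.
Qed.

Lemma bernoulli_onem (z : R) k : 0 <= z <= 1 -> 1 - k%:R * z <= (1 - z) ^+ k.
Proof.
case/andP=> z0 z1; elim: k => [|k ih]; first by rewrite mul0r subr0 expr0.
have k0 : 0 <= k%:R :> R by [].
have : (1 - z) * (1 - k%:R * z) <= (1 - z) ^+ k.+1.
  by rewrite exprS ler_wpM2l//; lra.
have := mulr_ge0 k0 (mulr_ge0 z0 z0).
rewrite -natr1; lra.
Qed.

Lemma bernoulli_onep (z : R) k : 0 <= z -> 1 + k%:R * z <= (1 + z) ^+ k.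
Proof.
move=> z0; elim: k => [|k ih]; first by rewrite mul0r addr0 expr0.
have k0 : 0 <= k%:R :> R by [].
have : (1 + z) * (1 + k%:R * z) <= (1 + z) ^+ k.+1.
  by rewrite exprS ler_wpM2l//; lra.
have := mulr_ge0 k0 (mulr_ge0 z0 z0).
rewrite -natr1; lra.
Qed.

(* The polynomials [(1 - y^m)^(2^m)] of Brosowski and Deutsch tend to [1] for
   [0 <= y < 1/2] and to [0] for [1/2 < y <= 1]. *)
Lemma brosowski_deutsch (eta e : R) : 0 < eta -> 0 < e -> exists m : nat,
  forall y, 0 <= y <= 1 ->
  [/\ 0 <= (1 - y ^+ m) ^+ (2 ^ m) <= 1,
      (2 * y <= 1 - eta -> 1 - e <= (1 - y ^+ m) ^+ (2 ^ m)) &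
      (1 + eta <= 2 * y -> (1 - y ^+ m) ^+ (2 ^ m) <= e)].
Proof.
(* One ratio serves both ends: 1 - eta <= r, and r^m is the inverse of (1+eta)^m. *)
move=> eta0 e0; set r := (1 + eta)^-1.
have r0 : 0 < r by rewrite invr_gt0; lra.
have r1 : `|r| < 1 by rewrite gtr0_norm// invf_lt1; lra.
have [m _ /(_ m (leqnn m)) rm] : \forall m \near \oo, r ^+ m < e.
  have /cvgrPdist_lt /(_ e e0) := cvg_expr r1.
  by apply: filterS => m; rewrite sub0r normrN normrX gtr0_norm.
exists m => y /andP[y0 y1].
have ym01 : 0 <= y ^+ m <= 1 by rewrite exprn_ge0//= exprn_ile1.
have /andP[ym0 ym1] := ym01.
(* This identity places the threshold at y = 1/2: Bernoulli's inequality with exponent 2^m sees the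
   m-th power of 2y. *)
have E2 : (2 ^ m)%:R * y ^+ m = (2 * y) ^+ m by rewrite natrX exprMn.
split.
- by rewrite exprn_ge0 ?exprn_ile1//; lra.
- move=> ye; apply: le_trans (bernoulli_onem _ _ ym01); rewrite E2 lerD2l lerN2.
  rewrite (le_trans _ (ltW rm))// lerXn2r ?nnegrE//; first by lra.
    exact: ltW.
  rewrite (le_trans ye)// /r -div1r ler_pdivlMr; last lra.
  have := sqr_ge0 eta; lra.
- move=> ye; set z := y ^+ m in E2 ym0 ym1 ym01 *.
  (* Since (1-z)(1+z) <= 1, a lower bound on the power of 1+z becomes an upper bound on that of
     1-z. *)
  have z1 : (1 - z) ^+ (2 ^ m) * (1 + z) ^+ (2 ^ m) <= 1.
    rewrite -exprMn exprn_ile1//; first by rewrite mulr_ge0//; lra.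
    have := sqr_ge0 z; lra.
  have B := bernoulli_onep z (2 ^ m) ym0; rewrite E2 in B.
  have p0 : 0 < (1 + eta) ^+ m by rewrite exprn_gt0//; lra.
  have p1 : (1 + eta) ^+ m <= (2 * y) ^+ m by rewrite lerXn2r ?nnegrE//; lra.
  have a0 : 0 <= (1 - z) ^+ (2 ^ m) by rewrite exprn_ge0//; lra.
  have : (1 - z) ^+ (2 ^ m) * (1 + eta) ^+ m <= 1.
    by apply: le_trans z1; rewrite ler_wpM2l//; lra.
  rewrite -ler_pdivlMr// => /le_trans; apply.
  by rewrite div1r -exprVn ltW.
Qed.

(** The function built is periodic, so it can imitate a step only on a window |x| <= A; elsewhere
    only its values in [0,1] are controlled. *)
Lemma trig_step (c d A e : R) : 0 < d -> 0 < e ->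
  exists h : R -> R, [/\ trigpoly h, forall x, 0 <= h x <= 1,
    forall x, `|x| <= A -> x <= c - d -> 1 - e <= h x &
    forall x, `|x| <= A -> c + d <= x -> h x <= e].
Proof.
(* Large enough that (x-c)/L and d/L lie in [-1,1], inside [-pi/2,pi/2], where sine increases. *)
move=> d0 e0; pose L := `|A| + `|c| + d + 1.
have L1 : 1 <= L by rewrite lerDr !addr_ge0// ltW.
have L0 : 0 < L by lra.
have dL : 0 < d / L by rewrite divr_gt0.
have pi1 := @pihalf_ge1 R.
have win (u : R) : `|u| <= L -> u / L \in `[(- (pi / 2)), pi / 2].
  move=> uL; rewrite in_itv/= -ler_norml normrM normfV (gtr0_norm L0).
  by rewrite (le_trans _ pi1)// ler_pdivrMr// mul1r.
have dwin : `|d| <= L by rewrite gtr0_norm// /L; have := normr_ge0 A; have := normr_ge0 c; lra.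
have eta0 : 0 < sin (d / L).
  rewrite -sin0 ltr_sin//; last exact: win.
  by rewrite -(mul0r L^-1) win// normr0 ltW.
have sin_le (u v : R) : `|u| <= L -> `|v| <= L -> u <= v -> sin (u / L) <= sin (v / L).
  move=> uL vL uv; rewrite leNgt ltr_sin ?win// -leNgt.
  by rewrite ler_pM2r ?invr_gt0.
have [m hm] := brosowski_deutsch _ _ eta0 e0.
pose y x := (1 + sin ((x - c) / L)) / 2.
have y01 x : 0 <= y x <= 1.
  by have := sin_geN1 ((x - c) / L); have := sin_le1 ((x - c) / L); rewrite /y => *; apply/andP; split; lra.
have xwin x : `|x| <= A -> `|x - c| <= L.
  move=> xA; rewrite (le_trans (ler_normB _ _))// /L.
  have := ler_norm A; lra.
have ty : trigpoly y.
  apply: trigpoly_ext (trigpoly_add _ _ (trigpoly_cst (2^-1))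
     (trigpoly_cos 2^-1 L^-1 (- c / L - pi / 2))) _ => x.
  have xE : L^-1 * x + - c / L = (x - c) / L by ring.
  by rewrite addrA cosBpihalf xE /y; ring.
exists (fun x => (1 - y x ^+ m) ^+ (2 ^ m)); split.
- by apply: trigpoly_exp; apply: trigpoly_onem; exact: trigpoly_exp.
- by move=> x; case: (hm _ (y01 x)).
- move=> x xA xc; case: (hm _ (y01 x)) => _ + _; apply.
  have : sin ((x - c) / L) <= sin (- d / L).
    by apply: sin_le; rewrite ?xwin ?normrN//; lra.
  rewrite mulNr sinN /y; lra.
- move=> x xA xc; case: (hm _ (y01 x)) => _ _; apply.
  have : sin (d / L) <= sin ((x - c) / L).
    by apply: sin_le; rewrite ?xwin//; lra.
  rewrite /y; lra.
Qed.

(** Outside the window x^2/A^2 exceeds 1 and dominates any difference of values in [0,1]. *)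
Lemma trig_bracket (c d A e : R) : 0 < d -> 0 < e -> 0 < A ->
  exists h : R -> R, [/\ trigpoly h, forall x, `|h x| <= 1,
    forall x, (x <= c - d)%R%:R <= h x + e + (A ^+ 2)^-1 * x ^+ 2 &
    forall x, h x <= (x <= c + d)%R%:R + e + (A ^+ 2)^-1 * x ^+ 2].
Proof.
move=> d0 e0 A0; have [h [th h01 hl hr]] := trig_step c d A e d0 e0.
have q0 x : 0 <= (A ^+ 2)^-1 * x ^+ 2 by rewrite mulr_ge0 ?invr_ge0 ?sqr_ge0.
have q1 x : A < `|x| -> 1 <= (A ^+ 2)^-1 * x ^+ 2.
  move=> Ax; rewrite mulrC ler_pdivlMr ?exprn_gt0// mul1r.
  by rewrite -(real_normK (num_real x)) lerXn2r ?nnegrE// ltW.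
exists h; split=> // x; have /andP[h0 h1] := h01 x; have := q0 x.
- by rewrite ger0_norm.
- have [xA|/q1] := leP `|x| A.
    have [xc|xc] := leP x (c - d); last by rewrite /=; lra.
    by have := hl x xA xc; rewrite /=; lra.
  have : (x <= c - d)%R%:R <= 1 :> R by rewrite -[leRHS]/(1%:R) ler_nat leq_b1.
  by lra.
- have [xA|/q1] := leP `|x| A.
    have [xc|xc] := leP x (c + d); first by rewrite /=; lra.
    by have := hr x xA (ltW xc); rewrite /=; lra.
  have : 0 <= (x <= c + d)%R%:R :> R by exact: ler0n.
  by lra.
Qed.

End trigonometric_steps.

(* Continuity theorem for positive linear functionals [E n] (the means of
   functions of the n-th variable): trigonometric polynomials bracket indicators
   of half-lines up to [x^2 / A^2], which replaces tightness. *)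
Lemma cvg_cdf_of_charf (R : realType) (s V : R) (E : nat -> (R -> R) -> R) :
  s != 0 ->
  (forall n f g, E n (fun x => f x + g x) = E n f + E n g) ->
  (forall n k f, E n (fun x => k * f x) = k * E n f) ->
  (forall n f g, (forall x, f x <= g x) -> E n f <= E n g) ->
  (forall n, E n (fun=> 1) = 1) ->
  (forall n, E n (fun x => x ^+ 2) <= V) ->
  (forall t th, E n (fun x => cos (t * x + th)) @[n --> \oo] -->
     expR (- (t ^+ 2 * s ^+ 2 / 2)) * cos th) ->
  forall c, {for c, continuous (fun y : R => fine (normal_prob 0 s [set` `]-oo, y]]))} ->
  E n (fun x => (x <= c)%R%:R) @[n --> \oo] --> fine (normal_prob 0 s [set` `]-oo, c]]).
Proof.
move=> s0 ED EZ Ele E1 EV Echar c.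
under [X in {for _, continuous X}]eq_fun do rewrite -(normal_mean_cdf s).
rewrite -(normal_mean_cdf s).
set F := fun y : R => normal_mean s (fun x : R => (x <= y)%R%:R) => Fc.
have Etrig h : trigpoly h -> E n h @[n --> \oo] --> normal_mean s h.
  elim=> [k t th|f g tf ihf tg ihg].
    under eq_fun do rewrite EZ.
    rewrite (normal_meanZ s s0 k (fun x => cos (t * x + th)) 1); last 2 first.
    - apply: continuous_measurable_fun => x.
      by apply/differentiable_continuous/derivable1_diffP; exact: ex_derive.
    - by move=> x; exact: cos_max.
    by apply: cvgMl_tmp; rewrite normal_mean_cos//; exact: Echar.
  have [mf [K1 bf]] := trigpoly_measurable_bounded _ tf.
  have [mg [K2 bg]] := trigpoly_measurable_bounded _ tg.
  rewrite (normal_meanD s s0 f g (K1 + K2))//; last 2 first.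
  - by move=> x; rewrite (le_trans (bf x))// lerDl (le_trans _ (bg x)).
  - by move=> x; rewrite (le_trans (bg x))// lerDr (le_trans _ (bf x)).
  under eq_fun do rewrite ED.
  exact: cvgD.
have mind (y : R) : measurable_fun setT (fun x : R => (x <= y)%R%:R : R).
  have -> : (fun x : R => (x <= y)%R%:R : R) = \1_[set` `]-oo, y]].
    apply/funext => x; rewrite indicE; congr (nat_of_bool _)%:R.
    by apply/idP/idP; rewrite inE /= in_itv.
  exact: measurable_indic.
have bind (y x : R) : `|(x <= y)%R%:R : R| <= 1.
  by rewrite ger0_norm// -[leRHS]/(1%:R) ler_nat leq_b1.
apply/cvgrPdist_le => e6 e60.
(* Two brackets cost 2e each, the convergence for the trigonometric polynomial e, and the continuity
   of the Gaussian cdf at [c] another e. *)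
pose e := e6 / 6; have e0 : 0 < e by rewrite /e; lra.
have [d d0 Fd] : exists2 d : R, 0 < d & F (c + 2 * d) <= F c + e /\ F c - e <= F (c - 2 * d).
  move/cvgrPdist_le : Fc => /(_ e e0) [r /= r0 Hr].
  have h1 : `|F c - F (c + 2 * (r / 4))| <= e.
    by apply: Hr; rewrite /= opprD addrA subrr sub0r normrN gtr0_norm; lra.
  have h2 : `|F c - F (c - 2 * (r / 4))| <= e.
    by apply: Hr; rewrite /= opprB addrCA subrr addr0 gtr0_norm; lra.
  exists (r / 4); first by lra.
  move: h1 h2; rewrite !ler_norml => /andP[? ?] /andP[? ?].
  by split; lra.
pose W := `|V| + `|normal_mean s (fun x => x ^+ 2)| + 1.
have W0 : 0 < W by rewrite ltr_wpDl// addr_ge0.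
(* Then [k] = e/W with W above both second moments, so the quadratic term costs at most e under
   [E n] and under the Gaussian. *)
pose A := Num.sqrt (W / e).
have We0 : 0 < W / e by exact: divr_gt0.
have A0 : 0 < A by rewrite sqrtr_gt0.
pose k := (A ^+ 2)^-1.
have kE : k = e / W by rewrite /k (sqr_sqrtr (ltW We0)) invf_div.
have kle z : z <= W -> k * z <= e.
  move=> zW; rewrite kE mulrAC ler_pdivrMr// ler_wpM2l//; exact: ltW.
have kV n : k * E n (fun x => x ^+ 2) <= e.
  rewrite kle// (le_trans (EV n))// (le_trans (ler_norm _))// /W -addrA lerDl.
  by rewrite addr_ge0.
have kG : k * normal_mean s (fun x => x ^+ 2) <= e.
  rewrite kle// (le_trans (ler_norm _))// /W addrAC lerDr.
  by rewrite addr_ge0.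
have Ebr n (f g : R -> R) : (forall x, f x <= g x + e + k * x ^+ 2) -> E n f <= E n g + 2 * e.
  move=> fg.
  have : E n f <= E n (fun x => g x + e * 1 + k * x ^+ 2).
    by apply: Ele => x; rewrite mulr1.
  rewrite (ED n (fun x => g x + e * 1)) (ED n g (fun=> e * 1)) !EZ E1 mulr1.
  have := kV n; lra.
have Nbr (f g : R -> R) : measurable_fun setT f -> measurable_fun setT g ->
    (forall x, `|f x| <= 1) -> (forall x, `|g x| <= 1) ->
    (forall x, f x <= g x + e + k * x ^+ 2) ->
    normal_mean s f <= normal_mean s g + 2 * e.
  move=> mf mg bf bg fg.
  have := normal_mean_le_sqr s s0 f g 1 e k mf mg bf bg fg; have := kG; lra.
(* Centred at c+d, [hu] separates the thresholds c and c+2d; centred at c-d, [hl] separates c-2d and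
   c. *)
have [hu [tu bu lu ul]] := trig_bracket (c + d) d A e d0 e0 A0.
have [hl [tl bl ll lr]] := trig_bracket (c - d) d A e d0 e0 A0.
have [mhu _] := trigpoly_measurable_bounded _ tu.
have [mhl _] := trigpoly_measurable_bounded _ tl.
rewrite addrK in lu; rewrite subrK in lr.
have cd2 : c + d + d = c + 2 * d by ring.
have cd2' : c - d - d = c - 2 * d by ring.
rewrite cd2 in ul; rewrite cd2' in ll.
have Nu : normal_mean s hu <= F (c + 2 * d) + 2 * e by exact: Nbr.
have Nl : F (c - 2 * d) <= normal_mean s hl + 2 * e by exact: Nbr.
have /cvgrPdist_le /(_ e e0) nu := Etrig hu tu.
have /cvgrPdist_le /(_ e e0) nl := Etrig hl tl.
near=> n; rewrite -/(F c).
have := Ebr n _ _ lu; have := Ebr n _ _ lr.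
have : `|normal_mean s hu - E n hu| <= e by near: n.
have : `|normal_mean s hl - E n hl| <= e by near: n.
have e6E : e6 = 6 * e by rewrite /e; field.
case: Fd => Fd1 Fd2.
rewrite !ler_norml => /andP[? ?] /andP[? ?] ? ?.
by apply/andP; split; rewrite e6E; lra.
Unshelve. all: by end_near. Qed.

(** * The law of the process *)

Lemma measure_ae_eq (d : measure_display) (T : measurableType d) (R : realType)
    (mu : {measure set T -> \bar R}) (A B : set T) :
  measurable A -> measurable B -> {ae mu, forall w, A w <-> B w} -> mu A = mu B.
Proof.
move=> mA mB [N [mN N0 AB]].
have key (C D : set T) : measurable C -> measurable D ->
    (forall w, C w -> D w \/ N w) -> (mu C <= mu D)%E.
  move=> mC mD CD; apply: (@le_trans _ _ (mu (D `|` N))).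
    by apply: le_measure; rewrite ?inE//; exact: measurableU.
  by rewrite measureU0.
have ABN w : ~ N w -> (A w <-> B w).
  by move=> Nw; apply: contrapT => h; apply: Nw; apply: AB.
apply/eqP; rewrite eq_le; apply/andP; split; apply: key => // w;
  by have [Nw|Nw] := pselect (N w); [right|move/ABN: Nw => [? ?]; left; auto].
Qed.

Fixpoint rpath (y : nat -> bool) (n : nat) : seq bool :=
  if n is m.+1 then y n :: rpath y m else [:: y 0%N].

Lemma size_rpath y n : size (rpath y n) = n.+1.
Proof. by elim: n => //= n ->. Qed.

Lemma head_rpath y n : head false (rpath y n) = y n.
Proof. by case: n. Qed.

Lemma rpath_eq y z n : rpath y n = rpath z n <-> (forall i, (i <= n)%N -> y i = z i).
Proof.
elim: n => [|n ih] /=.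
  by split=> [[e] i|e]; [rewrite leqn0 => /eqP ->|rewrite e].
split=> [[e /ih h] i|e].
  by rewrite leq_eqVlt => /predU1P[->//|]; exact: h.
by rewrite e//; congr cons; apply/ih => i /leqW; exact: e.
Qed.

(** Every list of the right length is thus a path of some sequence, so that [cylinder] events reach
    all tuples in [path_mean]. *)
Lemma rpath_nth n (s : seq bool) : size s = n.+1 -> rpath (nth false (rev s)) n = s.
Proof.
elim: n s => [|n ih] [|c s]//= [sn].
  by rewrite (size0nil sn).
rewrite rev_cons nth_rcons size_rev sn ltnn eqxx; congr cons.
rewrite -[RHS](ih s sn); apply/rpath_eq => i ni.
by rewrite nth_rcons size_rev sn ltnS ni.
Qed.

Lemma csum_rpath (R : realType) (p : R) y n :
  csum p (rpath y n) = \sum_(t < n.+1) ((y t)%:R - p).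
Proof.
rewrite /csum; elim: n => [|n ih]; first by rewrite big_seq1 big_ord1.
by rewrite /= big_cons ih [RHS]big_ord_recr /= addrC.
Qed.

Lemma natr_bool_inj (R : realType) (b c : bool) : b%:R = c%:R :> R -> b = c.
Proof. by move/eqP; rewrite eqr_nat; case: b c => -[]. Qed.

Section chain_law.
Context {R : realType} {d : measure_display} {T : measurableType d}.
Context (P : probability T R) (X : nat -> T -> R) (p lam : R).
Hypothesis p01 : 0 < p < 1.
Hypothesis mX : forall t, measurable_fun setT (X t).
Hypothesis markovX : discrete_markov P X.
Hypothesis cdfX : forall t x, P [set w | X t w <= x] = (bernoulli_cdf p x)%:E.
Hypothesis pairX : forall t, P ([set w | X t w <= 0] `&` [set w | X t.+1 w <= 0])
  = ((1 - p) * trans p lam false false)%:E.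

Definition bit (w : T) (t : nat) : bool := 0 < X t w.

Let mle t x : measurable [set w | X t w <= x].
Proof.
rewrite -[X in measurable X]setTI.
have -> : [set w | X t w <= x] = X t @^-1` [set` `]-oo, x]].
  by apply/seteqP; split=> w /=; rewrite in_itv.
exact: mX.
Qed.

Let meq t x : measurable [set w | X t w = x].
Proof. by rewrite -[X in measurable X]setTI; exact: (mX t measurableT [set x]). Qed.

Let bitF t : [set w | bit w t = false] = [set w | X t w <= 0].
Proof. by apply/seteqP; split=> w /=; rewrite /bit ltNge; [move/negbFE|move->]. Qed.

Let bitT t : [set w | bit w t = true] = ~` [set w | X t w <= 0].
Proof. by apply/seteqP; split=> w /=; rewrite /bit ltNge; move/negP. Qed.

Let mbit t b : measurable [set w | bit w t = b].
Proof. by case: b; rewrite ?bitT ?bitF; [apply: measurableC|]. Qed.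

Let cdf0 t : P [set w | X t w <= 0] = (1 - p)%:E.
Proof. by rewrite cdfX /bernoulli_cdf ltxx ltr01. Qed.

Let setIC_law (C D : set T) (x y : R) : measurable C -> measurable D ->
  P C = x%:E -> P (C `&` D) = y%:E -> P (C `&` ~` D) = (x - y)%:E.
Proof.
move=> mC mD PC PCD; rewrite -setDE EFinB.
have fC : (P C < +oo)%E by rewrite PC ltry.
rewrite -PC -PCD; exact: (measureD mC mD fC).
Qed.

Lemma ae_bit : {ae P, forall w, forall t, X t w = (bit w t)%:R}.
Proof.
apply/ae_foralln => t.
(* The cdf is constant on the negative reals and on [0,1[; countably many null sets exhaust X < 0
   and 0 < X < 1, and [N3] handles X > 1. *)
pose N1 k := [set w | X t w <= - k.+1%:R^-1].
pose N2 k := [set w | X t w <= 1 - k.+1%:R^-1] `\` [set w | X t w <= 0].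
pose N3 := ~` [set w | X t w <= 1].
have n1 k : P.-negligible (N1 k).
  have e : P (N1 k) = 0%E.
    have neg : - k.+1%:R^-1 < 0 :> R by rewrite oppr_lt0 invr_gt0 ltr0n.
    by rewrite /N1 cdfX /bernoulli_cdf neg.
  by apply/negligibleP; [exact: mle|exact: e].
have n2 k : P.-negligible (N2 k).
  have k1 : k.+1%:R^-1 <= 1 :> R by rewrite invf_le1// ler1n.
  have k0 : 0 < k.+1%:R^-1 :> R by rewrite invr_gt0.
  have e : P (N2 k) = 0%E.
    rewrite /N2 setDE -[RHS](_ : (1 - p - (1 - p))%:E = 0%E); last by rewrite subrr.
    apply: setIC_law => //.
      have y0 : (1 - k.+1%:R^-1 < 0 :> R) = false.
        by apply/negbTE; rewrite -leNgt subr_ge0.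
      have y1 : 1 - k.+1%:R^-1 < 1 :> R by rewrite ltrBlDr ltrDl.
      by rewrite cdfX /bernoulli_cdf y0 y1.
    rewrite (_ : _ `&` _ = [set w | X t w <= 0]) ?cdf0//.
    apply/seteqP; split=> [w [_ //]|w /= h]; split=> //=.
    by rewrite (le_trans h)// subr_ge0.
  by apply/negligibleP; [exact: measurableD|exact: e].
have n3 : P.-negligible N3.
  have e : P N3 = 0%E.
    rewrite /N3 probability_setC// cdfX /bernoulli_cdf ltxx ltNge ler01 /=.
    by rewrite subee.
  by apply/negligibleP; [exact: measurableC|exact: e].
suff : P.-negligible (~` [set w | X t w = (bit w t)%:R]) by [].
apply: (@negligibleS _ _ _ P ((\bigcup_k N1 k) `|` (\bigcup_k N2 k) `|` N3)).
  move=> w /= h; apply: contrapT => /not_orP[/not_orP[h1 h2]] h3; apply: h.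
  have x1 : X t w <= 1 by apply: contrapT.
  rewrite /bit; case: ltgtP => x0.
  - apply/eqP; rewrite eq_le x1 /= leNgt; apply/negP => lt1; apply: h2.
    have e0 : 0 < 1 - X t w by rewrite subr_gt0.
    exists (Num.truncn (1 - X t w)^-1) => //; split=> /=; last by apply/negP; rewrite -ltNge.
    rewrite lerBrDr addrC -lerBrDr -[leRHS]invrK lef_pV2 ?posrE ?invr_gt0//.
    exact/ltW/truncnS_gt.
  - exfalso; apply: h1.
    exists (Num.truncn (- X t w)^-1) => //=.
    rewrite /N1 /= lerNr -[leRHS]invrK lef_pV2 ?posrE ?invr_gt0 ?oppr_gt0//.
    exact/ltW/truncnS_gt.
  - by [].
by apply: negligibleU => //; apply: negligibleU; exact: negligible_bigcup.
Qed.

Definition pmf (b : bool) : R := if b then p else 1 - p.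

Let bit_law t b : P [set w | bit w t = b] = (pmf b)%:E.
Proof.
case: b; rewrite ?bitF ?bitT ?cdf0// probability_setC// cdf0 -EFinB.
by congr (_%:E); rewrite /pmf; ring.
Qed.

(** Both marginals being known, the corner (0,0) determines the other three entries by
    complementation. *)
Let pair_law t b c : P ([set w | bit w t = b] `&` [set w | bit w t.+1 = c])
  = (pmf b * trans p lam b c)%:E.
Proof.
pose A := [set w | X t w <= 0]; pose B := [set w | X t.+1 w <= 0].
have PA : P A = (1 - p)%:E := cdf0 t.
have PB : P B = (1 - p)%:E := cdf0 t.+1.
have PAB := pairX t; rewrite -/A -/B in PAB.
have mA : measurable A by exact: mle.
have mB : measurable B by exact: mle.
have PABc := setIC_law A B _ _ mA mB PA PAB.
have PBAc : P (B `&` ~` A) = ((1 - p) - (1 - p) * trans p lam false false)%:E.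
  by apply: setIC_law => //; rewrite setIC.
have PAc : P (~` A) = (1 - (1 - p))%:E by rewrite probability_setC// PA.
have PAcBc := setIC_law (~` A) B _ _ (measurableC mA) mB PAc.
rewrite setIC in PBAc.
case: b; case: c; rewrite ?bitF ?bitT -/A -/B.
- by rewrite (PAcBc _ PBAc) /trans /pmf; congr (_%:E); rewrite /=; ring.
- by rewrite PBAc /trans /pmf; congr (_%:E); rewrite /=; ring.
- by rewrite PABc /trans /pmf; congr (_%:E); rewrite /=; ring.
- by rewrite PAB.
Qed.

Let pmf_gt0 b : 0 < pmf b.
Proof. by case/andP: p01 => *; case: b; rewrite /pmf; lra. Qed.

Definition cylinder (y : nat -> bool) n := [set w | rpath (bit w) n = rpath y n].

Let cylinderE y n : cylinder y n = \bigcap_(i in `I_n.+1) [set w | bit w i = y i].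
Proof.
apply/seteqP; split=> w /=; first by move/rpath_eq => h i /=; rewrite ltnS => /h.
by move=> h; apply/rpath_eq => i ni; apply: h; rewrite /= ltnS.
Qed.

Let mcylinder y n : measurable (cylinder y n).
Proof. by rewrite cylinderE; apply: bigcap_measurable; [exists 0%N|move=> i _; exact: mbit]. Qed.

Let cylinder_ae (y : nat -> bool) n :
  P (\bigcap_(i in `I_n.+1) [set w | X i w = (y i)%:R]) = P (cylinder y n).
Proof.
apply: measure_ae_eq => //.
  by apply: bigcap_measurable; [exists 0%N|move=> i _; exact: meq].
apply: filterS ae_bit => w Xw; rewrite cylinderE.
split=> h i ni /=; last by rewrite Xw (h i ni).
by apply: (@natr_bool_inj R); rewrite -Xw; exact: h.
Qed.

(** The Markov property is given in product form; the common factor [pmf (y n)], positive because 0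
    < p < 1, is cancelled at each step. *)
Lemma cylinder_law y n : P (cylinder y n) = (path_weight p lam (rpath y n))%:E.
Proof.
elim: n => [|n ih].
  rewrite -[RHS](bit_law 0%N (y 0%N)); congr (P _).
  by apply/seteqP; split=> w; rewrite /cylinder /=; [case|move=> ->].
rewrite (_ : rpath y n.+1 = y n.+1 :: rpath y n)//.
rewrite path_weight_cons ?size_rpath// head_rpath.
have := markovX n (fun i => (y i)%:R).
rewrite (cylinder_ae y n.+1) (cylinder_ae y n) ih.
have one t : {ae P, forall w, X t w = (y t)%:R <-> bit w t = y t}.
  apply: filterS ae_bit => w Xw; rewrite Xw.
  by split=> [/natr_bool_inj|->].
have -> : P [set w | X n w = (y n)%:R] = P [set w | bit w n = y n].
  by apply: measure_ae_eq; [exact: meq|exact: mbit|exact: one].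
have -> : P ([set w | X n w = (y n)%:R] `&` [set w | X n.+1 w = (y n.+1)%:R])
    = P ([set w | bit w n = y n] `&` [set w | bit w n.+1 = y n.+1]).
  apply: measure_ae_eq; [by apply: measurableI; exact: meq|by apply: measurableI; exact: mbit|].
  apply: filterS2 (one n) (one n.+1) => w [a1 a2] [b1 b2].
  by split=> -[h1 h2]; split=> /=; [exact: a1|exact: b1|exact: a2|exact: b2].
rewrite bit_law pair_law -[P (cylinder y n.+1)]fineK ?fin_num_measure// -!EFinM => -[h].
congr (_%:E); apply: (mulIf (lt0r_neq0 (pmf_gt0 (y n)))); rewrite h; ring.
Qed.

Let path_fiber n (Q : pred (seq bool)) (s : n.+1.-tuple bool) :=
  [set w | rpath (bit w) n = s /\ Q s].

Let path_fiberE n Q s : @path_fiber n Q s =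
  if Q s then cylinder (nth false (rev s)) n else set0.
Proof.
rewrite /path_fiber /cylinder rpath_nth ?size_tuple//.
by case: ifP => q; apply/seteqP; split=> w //= [].
Qed.

Let mpath_fiber n Q s : measurable (@path_fiber n Q s).
Proof. by rewrite path_fiberE; case: ifP. Qed.

Let path_eventE n (Q : pred (seq bool)) : [set w | Q (rpath (bit w) n)] =
  \bigcup_(s in [set` index_enum (n.+1.-tuple bool)]) @path_fiber n Q s.
Proof.
apply/seteqP; split=> w /=; last by move=> [s _ [-> ]].
have sz : size (rpath (bit w) n) == n.+1 by rewrite size_rpath.
by exists (Tuple sz) => //=; rewrite mem_index_enum.
Qed.

Lemma measurable_path_event n (Q : pred (seq bool)) :
  measurable [set w | Q (rpath (bit w) n)].
Proof. by rewrite path_eventE; apply: fin_bigcup_measurable. Qed.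

Lemma path_law n (Q : pred (seq bool)) :
  P [set w | Q (rpath (bit w) n)] = (path_mean p lam n (fun s => (Q s)%:R))%:E.
Proof.
have PF (s : n.+1.-tuple bool) :
    P (@path_fiber n Q s) = (path_weight p lam s * (Q s)%:R)%:E.
  rewrite path_fiberE; case: ifP => q; last by rewrite measure0 mulr0.
  by rewrite cylinder_law rpath_nth ?size_tuple// mulr1.
rewrite path_eventE measure_fin_bigcup//; last first.
  by move=> s1 s2 _ _ [w [[e1 _] [e2 _]]]; apply: val_inj; rewrite /= -e1 -e2.
rewrite -fsbig_seq ?index_enum_uniq// /path_mean -sumEFin; apply: eq_bigr => s _.
exact: PF.
Qed.

End chain_law.

(** * Limit law of the sample mean *)

Lemma charf_cvg (R : realType) (p lam : R) : 0 < p < 1 -> `|lam| < 1 ->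
  (forall b c, 0 <= trans p lam b c) -> forall t th,
  path_mean p lam n (fun s => cos (t * (csum p s / Num.sqrt n.+1%:R) + th))
    @[n --> \oo] --> expR (- (t ^+ 2 * sig2 p lam / 2)) * cos th.
Proof.
move=> p01 lam1 q0 t th; have [K hK] := charf_rate p lam p01 lam1 q0 t th.
have K0 : K / Num.sqrt n.+1%:R @[n --> \oo] --> 0.
  rewrite -[X in _ --> X](mulr0 K); apply: cvgMl_tmp.
  have := cvg_comp _ _ (@cvg_harmonic R) (@sqrt_continuous R 0).
  by rewrite sqrtr0 /comp /harmonic; under eq_fun do rewrite sqrtrV//.
apply/subr_cvg0; apply: norm_cvg0.
apply: (@squeeze_cvgr _ _ _ _ (cst 0) _ _ _ _ _ K0); last exact: cvg_cst.
apply: nearW => n; rewrite normr_ge0 /=; apply: le_trans (hK n).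
rewrite le_eqVlt; apply/orP; left; apply/eqP; congr (`|_ - _|).
by congr path_mean; apply/funext => s; congr cos; ring.
Qed.

Theorem theorem4 (R : realType) (d : measure_display) (T : measurableType d)
    (P : probability T R) (X : nat -> T -> R) (a p : R) :
  0 < a < 1 -> 0 < p < 1 ->
  copula_markov_chain P X (mix_copula a) (bernoulli_cdf p) ->
  let sigma2 := if p < 2^-1 then p * (1 - p) * (1 + a - 2 * p) / (1 - a)
                else p * (1 - p) * (a + 2 * p - 1) / (1 - a) in
  cvg_in_distribution P
    (fun n w => Num.sqrt (n.+1)%:R
                * ((n.+1)%:R^-1 * (\sum_(t < n.+1) X t w) - p))
    (normal_prob 0 (Num.sqrt sigma2)).
Proof.
move=> a01 p01 [mX markovX cdfX copX] sigma2.
have [a0 a1] := andP a01; have [p0 p1] := andP p01.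
(* Found by equating C(1-p,1-p) = a(1-p) + (1-a)max(1-2p,0) with (1-p)(1-p+lam p). It may be
   negative. *)
pose lam : R := if p < 2^-1 then (a - p) / (1 - p) else (a - (1 - p)) / p.
have p0' : p != 0 by rewrite gt_eqF.
have p1' : 1 - p != 0 by rewrite subr_eq0 gt_eqF.
have a1' : 1 - a != 0 by rewrite subr_eq0 gt_eqF.
have lam1 : `|lam| < 1.
  rewrite /lam; case: (ltP p 2^-1) => ph; rewrite ltr_norml; apply/andP; split;
    rewrite ?ltr_pdivlMr ?ltr_pdivrMr ?subr_gt0//; lra.
have q0 b c : 0 <= trans p lam b c.
  have E1 : 0 <= lam * (1 - p) + p <= 1.
    rewrite /lam; case: (ltP p 2^-1) => ph; first by rewrite divfK//; apply/andP; split; lra.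
    have -> : (a - (1 - p)) / p * (1 - p) + p = (p * p + (a - (1 - p)) * (1 - p)) / p by field.
    by apply/andP; split; rewrite ?ler_pdivlMr ?ler_pdivrMr//; nra.
  have E2 : 0 <= p - lam * p <= 1.
    rewrite /lam; case: (ltP p 2^-1) => ph; last by rewrite divfK//; apply/andP; split; lra.
    have -> : p - (a - p) / (1 - p) * p = (p * (1 - a)) / (1 - p) by field.
    by apply/andP; split; rewrite ?ler_pdivlMr ?ler_pdivrMr ?subr_gt0//; nra.
  by case/andP: E1 => ? ?; case/andP: E2 => ? ?; case: b; case: c; rewrite /trans /=; lra.
have sig2E : sig2 p lam = sigma2.
  by rewrite /sig2 /sigma2 /lam; case: (ltP p 2^-1) => ph; field; rewrite ?p0' ?p1' ?a1'.
(* In each case the last factor of the numerator is at least a > 0, so the limit is nondegenerate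
   and has a density. *)
have sigma2_gt0 : 0 < sigma2.
  by rewrite /sigma2; case: (ltP p 2^-1) => ph; rewrite divr_gt0 ?mulr_gt0 ?subr_gt0//; lra.
have s0 : Num.sqrt sigma2 != 0 by rewrite gt_eqF// sqrtr_gt0.
have pairX t : P ([set w | X t w <= 0] `&` [set w | X t.+1 w <= 0])
    = ((1 - p) * trans p lam false false)%:E.
  rewrite copX /bernoulli_cdf ltxx ltr01 /mix_copula minxx; congr (_%:E).
  rewrite /trans /lam /=; case: (ltP p 2^-1) => ph.
    by rewrite max_l; [field|lra].
  by rewrite max_r; [field|lra].
pose E n (f : R -> R) :=
  path_mean p lam n (fun s => f (csum p s / Num.sqrt n.+1%:R)).
have law_W n x : P [set w | Num.sqrt n.+1%:R * (n.+1%:R^-1 * (\sum_(t < n.+1) X t w) - p) <= x]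
    = (E n (fun y => (y <= x)%R%:R))%:E.
  pose Q s := csum p s / Num.sqrt n.+1%:R <= x.
  rewrite -(path_law P X p lam p01 mX markovX cdfX pairX n Q).
  apply: measure_ae_eq.
  - rewrite -[X in measurable X]setTI.
    have mW : measurable_fun setT (fun w =>
        Num.sqrt n.+1%:R * (n.+1%:R^-1 * (\sum_(t < n.+1) X t w) - p)).
      apply: measurable_funM => //; apply: measurable_funB => //.
      by apply: measurable_funM => //; exact: measurable_sum.
    have -> : [set w | Num.sqrt n.+1%:R * (n.+1%:R^-1 * (\sum_(t < n.+1) X t w) - p) <= x]
      = (fun w => Num.sqrt n.+1%:R * (n.+1%:R^-1 * (\sum_(t < n.+1) X t w) - p))
        @^-1` [set` `]-oo, x]].
      by apply/seteqP; split=> w /=; rewrite in_itv.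
    exact: mW.
  - exact: measurable_path_event.
  - apply: filterS (ae_bit P X p mX cdfX) => w Xw /=.
    rewrite /Q csum_rpath.
    have -> : \sum_(t < n.+1) ((bit X w t)%:R - p) = \sum_(t < n.+1) X t w - n.+1%:R * p.
      rewrite big_split /= sumr_const card_ord mulNrn mulr_natl.
      by congr (_ - _); apply: eq_bigr => t _; rewrite Xw.
    set S := \sum_(t < n.+1) X t w.
    have r0 : Num.sqrt n.+1%:R != 0 :> R by rewrite gt_eqF// sqrtr_gt0 ltr0n.
    have scale (r N z : R) : r != 0 -> N = r ^+ 2 ->
        r * (N^-1 * z - p) = (z - N * p) / r by move=> r00 ->; field.
    by rewrite (scale _ _ _ r0)// sqr_sqrtr.
move=> x Fx.
have fin : normal_prob 0 (Num.sqrt sigma2) [set` `]-oo, x]] \is a fin_num.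
  exact: (fin_num_measure (normal_prob 0 (Num.sqrt sigma2)) _ (measurable_itv _)).
rewrite -(fineK fin); under eq_fun do rewrite law_W.
apply/fine_cvgP; split; first exact: nearW.
apply: (@cvg_cdf_of_charf R (Num.sqrt sigma2) (4 * jbound lam ^+ 2) E s0 _ _ _ _ _ _ x Fx).
- by move=> n f g; exact: path_meanD.
- by move=> n k f; exact: path_meanZ.
- by move=> n f g fg; apply: le_path_mean.
- by move=> n; exact: path_mean_cst.
- move=> n; rewrite /E.
  have N0 : 0 < n.+1%:R :> R by rewrite ltr0n.
  have -> : (fun s => (csum p s / Num.sqrt n.+1%:R) ^+ 2)
      = (fun s => n.+1%:R^-1 * csum p s ^+ 2).
    by apply/funext => s; rewrite exprMn exprVn sqr_sqrtr// mulrC.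
  rewrite path_meanZ ler_pdivrMl//; exact: path_mean_csum_sqr_le.
- move=> t th; rewrite sqr_sqrtr ?(ltW sigma2_gt0)// -sig2E.
  exact: charf_cvg.
Qed.
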